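(* Let $K$ be a field, let $\lambda=(\lambda_1,\ldots,\lambda_n)$ be a partition with $m:=\lambda_1\ge\lambda_2\ge\cdots\ge\lambda_n\ge 1$, let $R=K[x_1,\ldots,x_n,y_1,\ldots,y_m]$, and let $I_\lambda=(x_iy_j \mid 1\le i\le n,\ 1\le j\le\lambda_i)\subset R$ be the edge ideal of the Ferrers graph with partition $\lambda$. Let $s$ be the number of indices $i$ with $\lambda_i\ge 2$, so that $\lambda=(\lambda_1,\ldots,\lambda_s,1,\ldots,1)$ with $\lambda_s\geq 2$. Then: (1) A (not necessarily irredundant) primary decomposition of $I_\lambda$ is $$I_\lambda=\Big(\bigcap_{i=1}^{s}(x_1,\ldots,x_{i-1},y_1,\ldots,y_{\lambda_i})\Big)\cap(x_1,\ldots,x_s,y_1)\cap(x_1,\ldots,x_n).$$ (2) The minimal $\mathbb{Z}$-graded free resolution of $I_\lambda$ is $2$-linear, and the $i$-th Betti number is $$\beta_i(R/I_\lambda)=\binom{\lambda_1}{i}+\binom{\lambda_2+1}{i}+\binom{\lambda_3+2}{i}+\cdots+\binom{\lambda_n+n-1}{i}-\binom{n}{i+1}$$ for $1\le i\le\max_j\{\lambda_j+j-1\}$. (3) The Hilbert series of $R/I_\lambda$ is $$P(R/I_\lambda,t)=\frac{1}{(1-t)^m}+\frac{t}{(1-t)^{m+n+1}}\cdot\sum_{j=1}^n(1-t)^{\lambda_j+j}.$$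
   Context: A Ferrers graph is a bipartite graph on two disjoint vertex sets $\{x_1,\ldots,x_n\}$ and $\{y_1,\ldots,y_m\}$ such that if $(x_i,y_j)$ is an edge then so is $(x_p,y_q)$ for $1\le p\le i$, $1\le q\le j$, and such that $(x_1,y_m)$ and $(x_n,y_1)$ are edges. Its partition is $\lambda=(\lambda_1,\ldots,\lambda_n)$, with $\lambda_i$ the degree of $x_i$; then $\lambda_1=m\ge\lambda_2\ge\cdots\ge\lambda_n\ge1$ and the edges are exactly the $(x_i,y_j)$ with $j\le\lambda_i$. The polynomial ring $R$ is standard graded. The ideal $I_\lambda$ has a $2$-linear resolution if it is generated in degree $2$ and all maps in its minimal graded free resolution are given by matrices of linear forms; equivalently, for $i\ge1$, the $i$-th free module in the minimal graded free resolution of $R/I_\lambda$ is $R(-i-1)^{\beta_i}$. Here $\beta_i(R/I_\lambda)=\dim_K\mathrm{Tor}_i^R(R/I_\lambda,K)$ and $P(R/I_\lambda,t)=\sum_{k\ge0}\dim_K[R/I_\lambda]_k\,t^k$. In (1), for $i=1$ the list $x_1,\ldots,x_{i-1}$ is empty. *)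

(* Defs.v *)
From mathcomp Require Import all_boot all_order all_algebra.
From mathcomp.multinomials Require Import mpoly.

Set Implicit Arguments.
Unset Strict Implicit.
Unset Printing Implicit Defensive.

Import GRing.Theory.
Local Open Scope ring_scope.

(** * Ideals, given by their membership predicates *)

Definition gen_ideal (A : comNzRingType) (gs : seq A) (f : A) : Prop :=
  exists c : 'I_(size gs) -> A, f = \sum_(i < size gs) c i * gs`_i.

Definition is_ideal (A : comNzRingType) (Q : A -> Prop) : Prop :=
  [/\ Q 0, (forall a b, Q a -> Q b -> Q (a + b)) & (forall a b, Q b -> Q (a * b))].

Definition primary_ideal (A : comNzRingType) (Q : A -> Prop) : Prop :=
  [/\ is_ideal Q, ~ Q 1 &
      forall a b, Q (a * b) -> Q a \/ exists k : nat, Q (b ^+ k)].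

(* The components are the ideals generated by the members of [Gs]. *)
Definition primary_decomposition (A : comNzRingType) (I : A -> Prop)
    (Gs : seq (seq A)) : Prop :=
  (forall G, G \in Gs -> primary_ideal (gen_ideal G)) /\
  (forall f, I f <-> forall G, G \in Gs -> gen_ideal G f).

(** * Free resolutions of R/I over R = K[X_1, ..., X_N]

   The i-th free module is 'rV[R]_(rk i).  The differential from step i.+1 to
   step i is right multiplication by [dif i], and the augmentation onto R/I is
   right multiplication by [aug] followed by the projection from R to R/I. *)

Record free_complex (K : fieldType) (N : nat) := FreeComplex {
  rk : nat -> nat;
  dif : forall i : nat, 'M[{mpoly K[N]}]_(rk i.+1, rk i);
  aug : 'cV[{mpoly K[N]}]_(rk 0) }.

Definition free_resolution (K : fieldType) (N : nat)
    (I : {mpoly K[N]} -> Prop) (F : free_complex K N) : Prop :=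
  [/\ (forall f, exists v : 'rV_(rk F 0), I (f - (v *m aug F) 0 0)),
      (forall v : 'rV_(rk F 0),
         I ((v *m aug F) 0 0) <-> exists w, v = w *m dif F 0) &
      (forall i (v : 'rV_(rk F i.+1)),
         v *m dif F i = 0 <-> exists w, v = w *m dif F i.+1)].

(* The differential tensored with K = R/(X_1, ..., X_N). *)
Definition dif_bar (K : fieldType) (N : nat) (F : free_complex K N) (i : nat) :
    'M[K]_(rk F i.+1, rk F i) :=
  map_mx (mcoeff 0%MM) (dif F i).

(* The subtractions do not truncate when F is a complex. *)
Definition dim_homology_bar (K : fieldType) (N : nat) (F : free_complex K N)
    (i : nat) : nat :=
  match i with
  | 0 => (rk F 0 - \rank (dif_bar F 0))%N
  | i'.+1 => (\rank (kermx (dif_bar F i')) - \rank (dif_bar F i'.+1))%N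
  end.

(* dim_K Tor_i(R/I, K) = b, with Tor computed from any resolution of R/I by
   finitely generated free modules. *)
Definition betti (K : fieldType) (N : nat) (I : {mpoly K[N]} -> Prop)
    (i b : nat) : Prop :=
  (exists F : free_complex K N, free_resolution I F) /\
  (forall F : free_complex K N, free_resolution I F -> dim_homology_bar F i = b).

(* Homogeneous of degree d for an integer d; only 0 is so when d < 0. *)
Definition zhomog (K : fieldType) (N : nat) (d : int) (p : {mpoly K[N]}) : Prop :=
  {in msupp p, forall m, (mdeg m)%:Z = d}.

(* The i-th free module is the direct sum over j of the R(- sh i j). *)
Definition graded (K : fieldType) (N : nat) (F : free_complex K N)
    (sh : forall i : nat, 'I_(rk F i) -> int) : Prop :=
  (forall j, zhomog (sh 0%N j) (aug F j 0)) /\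
  (forall i j k, zhomog (sh i.+1 j - sh i k) (dif F i j k)).

(* Every differential maps into (X_1, ..., X_N) times its codomain. *)
Definition minimal (K : fieldType) (N : nat) (F : free_complex K N) : Prop :=
  forall i j k, (dif F i j k)@_0%MM = 0.

Definition minimal_graded_resolution (K : fieldType) (N : nat)
    (I : {mpoly K[N]} -> Prop) (F : free_complex K N)
    (sh : forall i : nat, 'I_(rk F i) -> int) : Prop :=
  [/\ free_resolution I F, graded sh & minimal F].

(* Since F resolves R/I, step 1 carries the generators of I and the
   resolution of I itself starts there. *)
Definition two_linear (K : fieldType) (N : nat) (F : free_complex K N)
    (sh : forall i : nat, 'I_(rk F i) -> int) : Prop :=
  (forall j, sh 1%N j = 2) /\
  (forall i j k, dif F i.+1 j k \is 1.-homog).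

Definition has_two_linear_resolution (K : fieldType) (N : nat)
    (I : {mpoly K[N]} -> Prop) : Prop :=
  (exists (F : free_complex K N) (sh : forall i : nat, 'I_(rk F i) -> int),
     minimal_graded_resolution I sh) /\
  (forall (F : free_complex K N) (sh : forall i : nat, 'I_(rk F i) -> int),
     minimal_graded_resolution I sh -> two_linear sh).

(** * Hilbert functions and formal power series *)

(* dim_K [R/I]_k = d: the classes of some e_0, ..., e_(d-1) in R_k form a
   basis of R_k / (I :&: R_k). *)
Definition dim_quotient (K : fieldType) (N : nat) (I : {mpoly K[N]} -> Prop)
    (k d : nat) : Prop :=
  exists e : 'I_d -> {mpoly K[N]},
    [/\ (forall i, e i \is k.-homog),
        (forall f, f \is k.-homog ->
           exists c : 'I_d -> K, I (f - \sum_(i < d) c i *: e i)) &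
        (forall c : 'I_d -> K,
           I (\sum_(i < d) c i *: e i) -> forall i, c i = 0)].

(* A formal power series over int is its sequence of coefficients. *)
Definition fps := nat -> int.

Definition fps_poly (p : {poly int}) : fps := fun k => p`_k.

Definition fps_add (f g : fps) : fps := fun k => f k + g k.

Definition fps_mul (f g : fps) : fps :=
  fun k => \sum_(i < k.+1) f i * g (k - i)%N.

Definition fps_exp (f : fps) (a : nat) : fps :=
  iter a (fps_mul f) (fps_poly 1).

(* The series 1/(1 - t). *)
Definition fps_geom : fps := fun=> 1.

Lemma fps_geomP : fps_mul (fps_poly (1 - 'X)) fps_geom =1 fps_poly 1.
Proof.
move=> k; rewrite /fps_mul /fps_poly /fps_geom.
under eq_bigr do rewrite mulr1 coefB coef1 coefX.
case: k => [|k]; first by rewrite big_ord1 coef1.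
by rewrite big_ord_recl big_ord_recl /= big1 ?addr0 ?coef1.
Qed.

Definition hilbert_series (K : fieldType) (N : nat) (I : {mpoly K[N]} -> Prop)
    (P : fps) : Prop :=
  forall k, exists2 d : nat, dim_quotient I k d & P k = d%:Z.

(** * Ferrers ideals

   Sequences and ordinals are indexed from 0: [nth 0 lam i] is lambda_(i+1),
   and [xvar], [yvar] at index i are x_(i+1), y_(i+1). *)

Definition is_partition (lam : seq nat) : bool :=
  sorted geq lam && all (leq 1) lam.

Definition xvar (K : fieldType) (n m : nat) (i : 'I_n) : {mpoly K[n + m]} :=
  'X_(lshift m i).

Definition yvar (K : fieldType) (n m : nat) (j : 'I_m) : {mpoly K[n + m]} :=
  'X_(rshift n j).

(* x_1, ..., x_a, y_1, ..., y_b *)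
Definition var_gens (K : fieldType) (n m a b : nat) : seq {mpoly K[n + m]} :=
  [seq xvar K m i | i : 'I_n <- enum 'I_n & (i < a)%N] ++
  [seq yvar K n j | j : 'I_m <- enum 'I_m & (j < b)%N].

Definition ferrers_gens (K : fieldType) (lam : seq nat) :
    seq {mpoly K[size lam + head 0%N lam]} :=
  [seq xvar K _ p.1 * yvar K _ p.2
     | p : 'I_(size lam) * 'I_(head 0%N lam) <- enum predT
       & (p.2 < nth 0%N lam p.1)%N].

Definition ferrers_ideal (K : fieldType) (lam : seq nat) :
    {mpoly K[size lam + head 0%N lam]} -> Prop :=
  gen_ideal (ferrers_gens K lam).

Arguments ferrers_ideal K lam f : clear implicits.

(* Main.v *)
Require Import Defs.
From mathcomp Require Import all_boot all_order all_algebra.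
From mathcomp.multinomials Require Import mpoly.

Set Implicit Arguments.
Unset Strict Implicit.
Unset Printing Implicit Defensive.

Import GRing.Theory.
Local Open Scope ring_scope.

(** A Ferrers ideal I has linear quotients. List its generators x_i y_j in the
lexicographic order of (i, j), with indices from 0. The colon ideal of the
earlier generators by x_i y_j is generated by the variables x_p with p < i and
y_q with q < j, because the graph is closed under decreasing indices
([ferrers_pred_colon]). If J is generated by monomials and f is one more, then
multiplication by f embeds R/(J : f) into R/J with cokernel R/(J + (f)), so the
mapping cone of a lift of this map to free resolutions resolves R/(J + (f))
([cone_resolution]). Starting from 0 and adjoining variables this builds the
Koszul complexes; starting from 0 and adjoining the x_i y_j it glues one Koszul
complex on i + j variables for each generator. The degrees of all generators
stay on the linear strand, so the result is a minimal linear resolution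
([ferrers_resolution]). Its rank in step k is the sum of C(i + j, k - 1) over
the edges, and summing first along the rows gives the stated Betti numbers
([ferrers_bettiE]).

The Betti numbers and the linearity are asserted for every resolution. Any two
resolutions admit comparison maps, unique up to homotopy ([chain_map_lift],
[chain_map_homotopy]). Reduced modulo the variables, the homotopies vanish in
the homology, which is thus the reduction of the minimal resolution itself
([dim_homology_bar_minimal]). For two minimal graded resolutions the reduced
comparison maps are invertible; the degree 0 part of a comparison map is a
comparison map, and its constant entries relate generators of equal degree, so
the degrees agree ([minimal_shift_unique]).

The other two parts are about monomials. A polynomial lies in an ideal generated
by monomials when each of its monomials is divisible by a generator. For the
primary decomposition, a monomial lying in all the components involves some
x_i, and the component attached to the least such i supplies the y_j of an edge
([ferrers_pred_components]); the components are generated by variables and so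
are prime. For the Hilbert series, the monomials outside I are those in the y_j
alone, and, for each a, the products of x_a with the monomials in the x_i with
i >= a and the y_j not adjacent to x_a ([ferrers_std_count]). *)

(** * Monomial ideals *)

Section MonomialIdeals.

Context (K : fieldType) (N : nat).
Implicit Types (f g h : {mpoly K[N]}) (m u w : 'X_{1..N}) (P : pred 'X_{1..N}).

Definition mpart P f : {mpoly K[N]} := \sum_(m <- msupp f | P m) f@_m *: 'X_[m].

Lemma mcoeff_mpart P f m : (mpart P f)@_m = if P m then f@_m else 0.
Proof.
rewrite /mpart raddf_sum /=.
under eq_bigr do rewrite mcoeffZ mcoeffX.
case: (boolP (m \in msupp f)) => [mf|]; last first.
  rewrite mcoeff_msupp negbK => /eqP fm0; rewrite fm0 if_same big1 // => k _.
  by case: eqP => [->|_]; rewrite ?fm0 ?mul0r ?mulr0.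
rewrite big_mkcond (bigD1_seq m) ?msupp_uniq //= big1 ?addr0.
  by case: (P m); rewrite ?eqxx ?mulr1.
by move=> k /negPf km; rewrite km mulr0 if_same.
Qed.

Definition upset P := forall m m', P m -> P (m + m')%MM.

(** For an up-closed [P], the ideal spanned over [K] by the monomials in [P]. *)
Definition mon_ideal P f : bool := all P (msupp f).

Lemma mon_idealP P f : reflect (forall m, f@_m != 0 -> P m) (mon_ideal P f).
Proof.
by apply: (iffP allP) => H m; have := H m; rewrite mcoeff_msupp.
Qed.

Lemma eq_mon_ideal P P' : P =1 P' -> mon_ideal P =1 mon_ideal P'.
Proof. by move=> eqP f; apply: eq_all. Qed.

Lemma mon_ideal0 P : mon_ideal P 0.
Proof. by rewrite /mon_ideal msupp0. Qed.

Lemma mon_idealD P f g : mon_ideal P f -> mon_ideal P g -> mon_ideal P (f + g).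
Proof.
move=> /allP Pf /allP Pg; apply/allP => m /msuppD_le.
by rewrite mem_cat => /orP[/Pf|/Pg].
Qed.

Lemma mon_idealX P m : mon_ideal P 'X_[m] = P m.
Proof. by rewrite /mon_ideal msuppX /= andbT. Qed.

Lemma mon_ideal_is_ideal P : upset P -> is_ideal (mon_ideal P).
Proof.
move=> uP; split; [exact: mon_ideal0 | exact: mon_idealD |].
move=> f g /allP Pg; apply/allP => m /msuppM_le /allpairsP[[m1 m2] [_ /= m2g ->]].
by rewrite addmC; apply/uP/Pg.
Qed.

Lemma mon_ideal_mpart P Q f : mon_ideal P f -> mon_ideal P (mpart Q f).
Proof.
move=> /mon_idealP Pf; apply/mon_idealP => m; rewrite mcoeff_mpart.
by case: ifP => _; [apply: Pf | rewrite eqxx].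
Qed.

Lemma mon_ideal_colon P w f :
  mon_ideal P (f * 'X_[w]) = mon_ideal (fun m => P (m + w)%MM) f.
Proof.
rewrite /mon_ideal (perm_all _ (msuppMX _ _)) all_map.
by apply: eq_all => m /=; rewrite addmC.
Qed.

(** To reach [h] modulo [P], divide by [w] the terms of [h] outside [P]. *)
Lemma mon_ideal_adjoin P w h : upset P ->
  mon_ideal (fun m => P m || (w <= m)%MM) h <->
  exists g, mon_ideal P (h - g * 'X_[w]).
Proof.
move=> uP; split=> [/mon_idealP H | [g Pg]]; last first.
  rewrite -(subrK (g * 'X_[w]) h); apply: mon_idealD.
    by apply/mon_idealP => m ?; rewrite (mon_idealP _ _ Pg).
  rewrite mon_ideal_colon; apply/mon_idealP => m _.
  by rewrite lem_addl orbT.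
exists (\sum_(m <- msupp h | ~~ P m) h@_m *: 'X_[m - w]).
have -> : (\sum_(m <- msupp h | ~~ P m) h@_m *: 'X_[m - w]) * 'X_[w]
    = mpart (predC P) h.
  rewrite mulr_suml /mpart big_seq_cond [RHS]big_seq_cond.
  apply: eq_bigr => m /andP[mh nPm].
  rewrite -scalerAl -mpolyXD submK //.
  by have := H m; rewrite -mcoeff_msupp mh (negPf nPm) => /(_ isT).
apply/mon_idealP => m; rewrite mcoeffB mcoeff_mpart /=.
by case: (P m) => //=; rewrite subrr eqxx.
Qed.

Lemma gen_ideal_is_ideal (gs : seq {mpoly K[N]}) : is_ideal (gen_ideal gs).
Proof.
split=> [|a b [c ->] [d ->]|a b [c ->]].
- by exists (fun=> 0); rewrite big1 // => i _; rewrite mul0r.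
- exists (fun i => c i + d i); rewrite -big_split /=.
  by apply: eq_bigr => i _; rewrite mulrDl.
- exists (fun i => a * c i); rewrite mulr_sumr.
  by apply: eq_bigr => i _; rewrite mulrA.
Qed.

Lemma gen_ideal_mem (gs : seq {mpoly K[N]}) g : g \in gs -> gen_ideal gs g.
Proof.
move=> g_gs; have lt_i : (index g gs < size gs)%N by rewrite index_mem.
exists (fun i => (i == Ordinal lt_i)%:R); rewrite (bigD1 (Ordinal lt_i)) //=.
rewrite eqxx mul1r nth_index // big1 ?addr0 // => i /negPf ->.
by rewrite mul0r.
Qed.

Lemma ideal_sum (J : {mpoly K[N]} -> Prop) (T : Type) (r : seq T) (F : T -> {mpoly K[N]}) :
  is_ideal J -> (forall i, J (F i)) -> J (\sum_(i <- r) F i).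
Proof. by case=> J0 JD _ JF; apply: (big_ind J) => // i _. Qed.

Lemma upset_has_le (us : seq 'X_{1..N}) : upset (fun m => has (fun u => (u <= m)%MM) us).
Proof.
move=> m m' /hasP[u uus le_um]; apply/hasP; exists u => //.
exact: lepm_trans le_um (lem_addr _ _).
Qed.

Lemma gen_ideal_mon (us : seq 'X_{1..N}) f :
  gen_ideal [seq 'X_[u] | u <- us] f <->
  mon_ideal (fun m => has (fun u => (u <= m)%MM) us) f.
Proof.
have [_ _ MM] := mon_ideal_is_ideal (@upset_has_le us).
split=> [[c ->]|/mon_idealP H].
  apply: (ideal_sum (J := mon_ideal _)) => [|i].
    exact/mon_ideal_is_ideal/upset_has_le.
  apply: MM; have i_lt : (i < size us)%N by case: i => i /=; rewrite size_map.
  rewrite (nth_map 0%MM) // mon_idealX; apply/hasP.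
  by exists (nth 0%MM us i); rewrite ?mem_nth ?lepm_refl.
have idG := gen_ideal_is_ideal [seq 'X_[u] | u <- us]; have [G0 _ GM] := idG.
rewrite [f]mpolyE; apply: ideal_sum => // m.
have [->|/H /hasP[u uus le_um]] := eqVneq f@_m 0; first by rewrite scale0r.
rewrite -mul_mpolyC -(submK le_um) mpolyXD mulrA; apply: GM.
by apply: gen_ideal_mem; rewrite map_f.
Qed.

Definition vars_pred (S : seq 'I_N) : pred 'X_{1..N} := fun m => has (fun i => m i != 0%N) S.

Lemma upset_vars S : upset (vars_pred S).
Proof.
move=> m m' /hasP[i iS mi]; apply/hasP; exists i => //.
by rewrite mnmDE addn_eq0 negb_and mi.
Qed.

Lemma gen_ideal_vars (S : seq 'I_N) f :
  gen_ideal [seq 'X_i | i <- S] f <-> mon_ideal (vars_pred S) f.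
Proof.
have -> : [seq 'X_i : {mpoly K[N]} | i <- S] = [seq 'X_[u] | u <- [seq U_(i)%MM | i <- S]].
  by rewrite -map_comp.
rewrite gen_ideal_mon (eq_mon_ideal (P' := vars_pred S)) // => m /=.
by rewrite has_map; apply: eq_has => i /=; rewrite lep1mP.
Qed.

(** The quotient by an ideal generated by variables is a polynomial ring, hence
a domain: setting those variables to 0 is a ring endomorphism whose kernel is
the ideal. *)
Lemma gen_ideal_vars_prime (S : seq 'I_N) :
  primary_ideal (gen_ideal [seq 'X_i : {mpoly K[N]} | i <- S]).
Proof.
pose q : N.-tuple {mpoly K[N]} := [tuple if i \in S then 0 else 'X_i | i < N].
have qX m : 'X_[m] \mPo q = if vars_pred S m then 0 else 'X_[m].
  rewrite mpolyXE_id rmorph_prod /=.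
  under eq_bigr do rewrite rmorphXn /= comp_mpolyXU -tnth_nth tnth_mktuple.
  rewrite /vars_pred; case: hasP => [[i iS mi]|H].
    by rewrite (bigD1 i) //= iS expr0n (negPf mi) mul0r.
  apply: eq_bigr => i _; case: ifP => // iS.
  have [->|mi] := eqVneq (m i) 0%N; first by rewrite !expr0.
  by case: H; exists i.
have qE f : f \mPo q = mpart (predC (vars_pred S)) f.
  rewrite [f in LHS]mpolyE raddf_sum /mpart [RHS]big_mkcond /=; apply: eq_bigr => m _.
  by rewrite linearZ /= qX; case: vars_pred => //=; rewrite scaler0.
have kerE f : gen_ideal [seq 'X_i : {mpoly K[N]} | i <- S] f <-> f \mPo q = 0.
  rewrite gen_ideal_vars qE; split=> [/mon_idealP H|H].
    apply/mpolyP => m; rewrite mcoeff_mpart mcoeff0; case: ifP => //.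
    by move=> /= /negP nS; apply/eqP; apply/negPn/negP => /H.
  apply/mon_idealP => m; apply: contraR => nS.
  by rewrite -(mcoeff0 K m) -H mcoeff_mpart /= nS.
split; first exact: gen_ideal_is_ideal.
  by move/kerE/eqP; rewrite rmorph1 oner_eq0.
move=> a b /kerE; rewrite rmorphM => /eqP; rewrite mulf_eq0.
by case/orP => /eqP /kerE; [left | right; exists 1%N].
Qed.

End MonomialIdeals.

(** * Comparison of free resolutions *)

(** Dependent choice, constructive because the relation is decidable on choice
types; [Inv] carries what the existence of the next term needs. *)
Lemma dependent_choice_seq (T : nat -> choiceType) (Inv : forall i, T i -> Prop)
    (Rel : forall i, T i -> T i.+1 -> bool) :
  (exists x, Inv 0%N x) ->
  (forall i x, Inv i x -> exists y, Rel i x y) ->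
  (forall i x y, Inv i x -> Rel i x y -> Inv i.+1 y) ->
  exists s : forall i, T i, Inv 0%N (s 0%N) /\ forall i, Rel i (s i) (s i.+1).
Proof.
move=> [x0 Inv0] ex_next next_Inv.
pose next i (x : {x : T i | Inv i x}) : {x : T i.+1 | Inv i.+1 x} :=
  let y := xchoose (ex_next i _ (svalP x)) in
  exist _ y (next_Inv i _ y (svalP x) (xchooseP (ex_next i _ (svalP x)))).
pose s := nat_rect (fun i => {x : T i | Inv i x}) (exist _ x0 Inv0) next.
exists (fun i => sval (s i)); split=> [|i]; first exact: svalP.
exact: xchooseP (ex_next i _ (svalP (s i))).
Qed.

Lemma mx_factor (R : nzRingType) (a b c : nat) (A : 'M[R]_(a, c)) (D : 'M[R]_(b, c)) :
  (forall j, exists w, row j A = w *m D) -> exists B, A = B *m D.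
Proof.
move=> /fin_all_exists[w wP]; exists (\matrix_j w j).
by apply/row_matrixP => j; rewrite row_mul rowK.
Qed.

Section Comparison.

Context (K : fieldType) (N : nat).
Local Notation R := {mpoly K[N]}.
Implicit Types (F G : free_complex K N) (I J C : R -> Prop).

Lemma ideal_mulmx J (a b c : nat) (A : 'M[R]_(a, b)) (B : 'M[R]_(b, c)) : is_ideal J ->
  (forall j k, J (B j k)) -> forall j k, J ((A *m B) j k).
Proof.
move=> idJ JB j k; rewrite mxE; apply: ideal_sum => // l.
by case: idJ => _ _; apply.
Qed.

Lemma idealB J f g : is_ideal J -> J f -> J g -> J (f - g).
Proof. by case=> _ JD JM Jf Jg; apply: JD => //; rewrite -mulN1r; apply: JM. Qed.

Section Exactness.

Context (I : R -> Prop) (F : free_complex K N) (resF : free_resolution I F).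

Lemma dif_dif i : dif F i.+1 *m dif F i = 0.
Proof.
have [_ _ ex] := resF; apply/row_matrixP => j; rewrite row_mul row0.
by apply/ex; exists (delta_mx 0 j); rewrite rowE.
Qed.

Lemma dif_aug j : I ((dif F 0 *m aug F) j 0).
Proof.
have [_ ex _] := resF.
have -> : (dif F 0 *m aug F) j 0 = (row j (dif F 0) *m aug F) 0 0.
  by rewrite -row_mul [RHS]mxE.
by apply/ex; exists (delta_mx 0 j); rewrite rowE.
Qed.

Lemma factor_dif i a (A : 'M[R]_(a, rk F i.+1)) :
  A *m dif F i = 0 -> exists B, A = B *m dif F i.+1.
Proof.
have [_ _ ex] := resF => A0; apply: mx_factor => j; apply/ex.
by rewrite -row_mul A0 row0.
Qed.

Lemma factor_dif0 a (A : 'M[R]_(a, rk F 0)) :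
  (forall j, I ((A *m aug F) j 0)) -> exists B, A = B *m dif F 0.
Proof.
have [_ ex _] := resF => A0; apply: mx_factor => j; apply/ex.
by rewrite -row_mul [row _ _ _ _]mxE.
Qed.

Lemma lift_aug a (A : 'cV[R]_a) :
  exists B : 'M_(a, rk F 0), forall j, I ((A - B *m aug F) j 0).
Proof.
have [surj _ _] := resF.
have /fin_all_exists[w wP] j : exists v : 'rV_(rk F 0), I (A j 0 - (v *m aug F) 0 0).
  exact: surj.
exists (\matrix_j w j) => j.
have -> : (A - (\matrix_j w j) *m aug F) j 0 = A j 0 - (w j *m aug F) 0 0.
  by rewrite !mxE; congr (_ - _); apply: eq_bigr => k _; rewrite mxE.
exact: wP.
Qed.

End Exactness.

(** [phi] is a chain map covering multiplication by [f] on the cyclic modules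
that the two complexes resolve, the target being taken modulo [J]. *)
Definition chain_map J (f : R) F G (phi : forall i, 'M[R]_(rk F i, rk G i)) : Prop :=
  (forall j, J ((phi 0%N *m aug G - f *: aug F) j 0)) /\
  (forall i, phi i.+1 *m dif G i = dif F i *m phi i).

(** The comparison theorem: multiplication by [f] maps R/C to R/J as soon as
f C lies in J, and it lifts step by step because the target is exact. *)
Lemma chain_map_lift J C f F G : is_ideal J ->
  free_resolution C F -> free_resolution J G -> (forall g, C g -> J (f * g)) ->
  exists phi, @chain_map J f F G phi.
Proof.
move=> idJ resF resG CJ.
pose T i : choiceType := 'M[R]_(rk F i, rk G i).
pose Inv i : T i -> Prop := match i return T i -> Prop with
  | 0 => fun x => forall j, J ((x *m aug G - f *: aug F) j 0)
  | i'.+1 => fun x => dif F i'.+1 *m x *m dif G i' = 0 end.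
pose Rel i (x : T i) (y : T i.+1) := y *m dif G i == dif F i *m x.
case: (@dependent_choice_seq T Inv Rel).
- have [B BP] := lift_aug resG (f *: aug F); exists B => j.
  by rewrite -opprB mxE -mulN1r; case: idJ => _ _; apply.
- move=> [|i] x /= xP; last first.
    have [B xB] := factor_dif resG xP.
    by exists B; rewrite /Rel -xB.
  have [j|B xB] := factor_dif0 resG (A := dif F 0 *m x); last by exists B; rewrite /Rel -xB.
  rewrite -mulmxA -[x *m aug G](subrK (f *: aug F)) mulmxDr mxE.
  case: (idJ) => _ JD _; apply: JD; first by apply: ideal_mulmx => // l k; rewrite ord1.
  rewrite -scalemxAr mxE; apply: CJ; exact: dif_aug resF j.
- move=> i x y _ /eqP yP; rewrite /= -mulmxA yP mulmxA.
  by rewrite (dif_dif resF) mul0mx.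
by move=> phi [phi0 phiS]; exists phi; split=> // i; apply/eqP/phiS.
Qed.

(** In degree 0 a chain map covering 0 factors through the first differential of
the exact complex [G]. Correcting by the homotopy found so far makes the next
component a map into the kernel of a differential of [G], hence into the image
of the following one. *)
Lemma chain_map_homotopy J F G alpha : is_ideal J ->
  free_resolution J F -> free_resolution J G -> @chain_map J 0 F G alpha ->
  exists h : forall i, 'M[R]_(rk F i, rk G i.+1),
    forall i, alpha i.+1 = h i.+1 *m dif G i.+1 + dif F i *m h i.
Proof.
move=> idJ resF resG [alpha0 alphaS].
pose T i : choiceType := 'M[R]_(rk F i, rk G i.+1).
pose Inv i (x : T i) := dif F i *m (alpha i - x *m dif G i) = 0.
pose Rel i (x : T i) (y : T i.+1) := alpha i.+1 == y *m dif G i.+1 + dif F i *m x.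
case: (@dependent_choice_seq T Inv Rel).
- have [j|B aB] := factor_dif0 resG (A := alpha 0%N).
    by have := alpha0 j; rewrite scale0r subr0.
  by exists B; rewrite /Inv -aB subrr mulmx0.
- move=> i x xP; have [|B aB] := factor_dif resG (A := alpha i.+1 - dif F i *m x).
    by rewrite mulmxBl alphaS -mulmxA -mulmxBr.
  by exists B; rewrite /Rel -aB subrK.
- move=> i x y _ /eqP yP; rewrite /Inv yP addrC addrA addNr add0r mulmxA.
  by rewrite (dif_dif resF) mul0mx.
by move=> h [_ hS]; exists h => i; apply/eqP/hS.
Qed.

Definition bar a b (A : 'M[R]_(a, b)) : 'M[K]_(a, b) := map_mx (mcoeff 0%MM) A.

(** The composite covers 1, so that its difference with the identity covers 0. *)
Lemma bar_roundtrip I F G phi psi : is_ideal I ->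
  free_resolution I F -> free_resolution I G ->
  @chain_map I 1 F G phi -> @chain_map I 1 G F psi ->
  exists h : forall i, 'M[R]_(rk F i, rk F i.+1), forall i,
    bar (phi i.+1) *m bar (psi i.+1) - 1%:M
    = bar (h i.+1) *m dif_bar F i.+1 + dif_bar F i *m bar (h i).
Proof.
move=> idI resF resG [phi0 phiS] [psi0 psiS].
have alphaP : @chain_map I 0 F F (fun i => phi i *m psi i - 1%:M).
  split=> [j|i]; last first.
    by rewrite mulmxBl mulmxBr mulmx1 mul1mx -mulmxA psiS mulmxA phiS mulmxA.
  rewrite scale0r subr0 mulmxBl mul1mx.
  have -> : phi 0%N *m psi 0%N *m aug F - aug F
      = phi 0%N *m (psi 0%N *m aug F - 1 *: aug G) + (phi 0%N *m aug G - 1 *: aug F).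
    by rewrite !scale1r mulmxBr mulmxA addrA subrK.
  rewrite mxE; case: (idI) => _ ID _; apply: ID => //.
  by apply: ideal_mulmx => // l k; rewrite ord1.
have [h hP] := chain_map_homotopy idI resF resF alphaP.
exists h => i; move/(congr1 (@bar _ _)): (hP i).
by rewrite /bar map_mxB map_mxD !map_mxM map_mx1.
Qed.

Lemma dif_bar_min F i : minimal F -> dif_bar F i = 0.
Proof. by move=> minF; apply/matrixP => j k; rewrite !mxE minF. Qed.

(** Both terms of the homotopy contain a differential, with entries in the ideal
of the variables. *)
Lemma bar_roundtrip_minimal I F G phi psi : is_ideal I -> minimal F ->
  free_resolution I F -> free_resolution I G ->
  @chain_map I 1 F G phi -> @chain_map I 1 G F psi ->
  forall i, bar (phi i.+1) *m bar (psi i.+1) = 1%:M.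
Proof.
move=> idI minF resF resG cphi cpsi i.
have [h /(_ i)] := bar_roundtrip idI resF resG cphi cpsi.
rewrite !dif_bar_min // mulmx0 mul0mx addr0 => /eqP.
by rewrite subr_eq0 => /eqP.
Qed.

End Comparison.

(** The kernel of [D1] is the direct sum of the image of [D2] and of the row
space of [B], which therefore is a copy of the homology; [A] splits it off. *)
Lemma homology_rank (K : fieldType) (a b c g : nat) (D1 : 'M[K]_(a, b)) (D2 : 'M[K]_(c, a))
    (A : 'M[K]_(a, g)) (B : 'M[K]_(g, a)) (H1 : 'M[K]_(a, c)) (H0 : 'M[K]_(b, a)) :
  B *m A = 1%:M -> B *m D1 = 0 -> D2 *m A = 0 -> D2 *m D1 = 0 ->
  A *m B - 1%:M = H1 *m D2 + D1 *m H0 ->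
  (\rank (kermx D1) - \rank D2)%N = g.
Proof.
move=> BA BD1 D2A D2D1 hom.
have ker_eq : (kermx D1 :=: B + D2)%MS.
  apply/eqmxP/andP; split; last first.
    by rewrite addsmx_sub !sub_kermx BD1 D2D1 !eqxx.
  have -> : kermx D1 = kermx D1 *m A *m B - kermx D1 *m H1 *m D2.
    have := congr1 (mulmx (kermx D1)) hom.
    rewrite mulmxBr mulmx1 mulmxDr !mulmxA mulmx_ker mul0mx addr0 => <-.
    by rewrite opprB addrC subrK.
  by rewrite -mulNmx addmx_sub_adds ?submxMl.
have dsj : (B :&: D2)%MS = 0.
  apply/eqP; rewrite -submx0; apply/rV_subP => u; rewrite sub_capmx.
  move=> /andP[/submxP[w uB] /submxP[z uD]].
  have := congr1 (mulmxr A) uB; rewrite /= -mulmxA BA mulmx1 uD -mulmxA D2A mulmx0.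
  by move=> w0; rewrite -uD uB -w0 mul0mx sub0mx.
have rB : \rank B = g by apply/eqP; apply/row_freeP; exists A.
by rewrite ker_eq mxrank_disjoint_sum // rB addnK.
Qed.

Section Betti.

Context (K : fieldType) (N : nat).
Local Notation R := {mpoly K[N]}.
Implicit Types (F G : free_complex K N) (I : R -> Prop).

Lemma chain_map_id I F G : is_ideal I ->
  free_resolution I F -> free_resolution I G -> exists phi, @chain_map K N I 1 F G phi.
Proof. by move=> idI resF resG; apply: chain_map_lift resF resG _ => // g; rewrite mul1r. Qed.

(** Any resolution has the homology of a minimal one after reduction modulo the
variables, and the reduced differentials of a minimal one vanish. *)
Lemma dim_homology_bar_minimal I F G i : is_ideal I ->
  free_resolution I F -> free_resolution I G -> minimal G ->
  dim_homology_bar F i.+1 = rk G i.+1.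
Proof.
move=> idI resF resG minG.
have [phi cphi] := chain_map_id idI resF resG.
have [psi cpsi] := chain_map_id idI resG resF.
have [h hP] := bar_roundtrip idI resF resG cphi cpsi.
have psiphi := bar_roundtrip_minimal idI minG resG resF cpsi cphi.
case: cphi cpsi => _ phiS [_ psiS].
have barM a b c (A : 'M[R]_(a, b)) (B : 'M[R]_(b, c)) : bar (A *m B) = bar A *m bar B.
  exact: map_mxM.
apply: (homology_rank (psiphi i) _ _ _ (hP i)).
- have := congr1 (@bar _ _ _ _) (psiS i); rewrite !barM.
  by rewrite [bar (dif G i)]dif_bar_min // mul0mx.
- have := congr1 (@bar _ _ _ _) (phiS i.+1); rewrite !barM.
  by rewrite [bar (dif G i.+1)]dif_bar_min // mulmx0.
- have := congr1 (@bar _ _ _ _) (dif_dif resF i); rewrite barM => ->.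
  by apply/matrixP => j k; rewrite !mxE mcoeff0.
Qed.

Lemma betti_minimal I G i : is_ideal I -> free_resolution I G -> minimal G ->
  betti I i.+1 (rk G i.+1).
Proof.
move=> idI resG minG; split; first by exists G.
by move=> F resF; apply: dim_homology_bar_minimal resG minG.
Qed.

End Betti.

(** * Graded chain maps *)

Section Graded.

Context (K : fieldType) (N : nat).
Local Notation R := {mpoly K[N]}.
Implicit Types (F G C : free_complex K N) (I J : R -> Prop) (d e : int) (p q : R).

Definition zpart d p : R := mpart (fun m => (mdeg m)%:Z == d) p.

Lemma mcoeff_zpart d p m : (zpart d p)@_m = if (mdeg m)%:Z == d then p@_m else 0.
Proof. exact: mcoeff_mpart. Qed.

Lemma zhomogP d p : zhomog d p <-> forall m, p@_m != 0 -> (mdeg m)%:Z = d.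
Proof. by split=> H m; have := H m; rewrite mcoeff_msupp. Qed.

Lemma zhomog0 d : zhomog d (0 : R).
Proof. by apply/zhomogP => m; rewrite mcoeff0 eqxx. Qed.

Lemma zhomogN d p : zhomog d p -> zhomog d (- p).
Proof. by move=> /zhomogP H; apply/zhomogP => m; rewrite mcoeffN oppr_eq0; apply: H. Qed.

Lemma zhomogX m : zhomog (mdeg m) ('X_[m] : R).
Proof.
by apply/zhomogP => k; rewrite mcoeffX; case: (m =P k) => [->|_]; rewrite ?eqxx.
Qed.

Lemma zhomog_zpart d p : zhomog d (zpart d p).
Proof. by apply/zhomogP => m; rewrite mcoeff_zpart; case: (_ =P d); rewrite ?eqxx. Qed.

Lemma zhomog_coef0 d p : zhomog d p -> d != 0 -> p@_0%MM = 0.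
Proof.
move=> /zhomogP H dn0; apply/eqP; apply: contraNT dn0 => /H.
by rewrite mdeg0 => <-.
Qed.

Lemma zpart_id d p : zhomog d p -> zpart d p = p.
Proof.
move=> /zhomogP H; apply/mpolyP => m; rewrite mcoeff_zpart.
by case: eqP => // dm; apply/eqP; rewrite eq_sym; apply/negPn/negP => /H.
Qed.

Lemma zpart_sum d (T : Type) (r : seq T) (p : T -> R) :
  zpart d (\sum_(i <- r) p i) = \sum_(i <- r) zpart d (p i).
Proof.
apply/mpolyP => m; rewrite mcoeff_zpart; case: ifP => md; rewrite !raddf_sum /=.
  by apply: eq_bigr => i _; rewrite mcoeff_zpart md.
by rewrite big1 // => i _; rewrite mcoeff_zpart md.
Qed.

Lemma zpartMr d e p q : zhomog e q -> zpart (d + e) (p * q) = zpart d p * q.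
Proof.
move=> /zhomogP H; apply/mpolyP => m; rewrite mcoeff_zpart !mcoeffM.
transitivity (\sum_(k : 'X_{1..N < (mdeg m).+1, (mdeg m).+1} | m == (k.1 + k.2)%MM)
   if (mdeg m)%:Z == d + e then p@_k.1 * q@_k.2 else 0).
  by case: (boolP ((mdeg m)%:Z == d + e)) => // _; rewrite big1.
apply: eq_bigr => k /eqP mk; rewrite mcoeff_zpart.
have [->|/H qe] := eqVneq q@_k.2 0; first by rewrite !mulr0 if_same.
have -> : ((mdeg m)%:Z == d + e) = ((mdeg k.1)%:Z == d).
  by rewrite [in LHS]mk mdegD PoszD -qe (inj_eq (addIr _)).
by case: ifP; rewrite ?mul0r.
Qed.

Lemma zpartMl d e p q : zhomog e q -> zpart (e + d) (q * p) = q * zpart d p.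
Proof. by move=> H; rewrite mulrC addrC zpartMr // mulrC. Qed.

(** A matrix between graded free modules with generators in degrees [r] and [c]
has degree 0 when its (j, k) entry is homogeneous of degree [r j - c k]. *)
Definition mxhomog a b (r : 'I_a -> int) (c : 'I_b -> int) (M : 'M[R]_(a, b)) :=
  forall j k, zhomog (r j - c k) (M j k).

Definition mxzpart a b (r : 'I_a -> int) (c : 'I_b -> int) (M : 'M[R]_(a, b)) :=
  \matrix_(j, k) zpart (r j - c k) (M j k).

Lemma mxzpart_homog a b (r : 'I_a -> int) (c : 'I_b -> int) M :
  mxhomog r c (mxzpart r c M).
Proof. by move=> j k; rewrite mxE; apply: zhomog_zpart. Qed.

Lemma mxzpart_id a b (r : 'I_a -> int) (c : 'I_b -> int) M :
  mxhomog r c M -> mxzpart r c M = M.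
Proof. by move=> H; apply/matrixP => j k; rewrite mxE zpart_id. Qed.

Lemma mxzpartB a b (r : 'I_a -> int) (c : 'I_b -> int) A B :
  mxzpart r c (A - B) = mxzpart r c A - mxzpart r c B.
Proof.
apply/matrixP => j k; rewrite !mxE; apply/mpolyP => m.
rewrite mcoeffB !mcoeff_zpart mcoeffB; case: ifP => // _.
by rewrite subrr.
Qed.

Lemma mxzpartMr a b n (r : 'I_a -> int) (c : 'I_b -> int) (s : 'I_n -> int) A B :
  mxhomog c s B -> mxzpart r s (A *m B) = mxzpart r c A *m B.
Proof.
move=> hB; apply/matrixP => j k; rewrite !mxE zpart_sum; apply: eq_bigr => l _.
by rewrite mxE -(zpartMr _ _ (hB l k)) addrA subrK.
Qed.

Lemma mxzpartMl a b n (r : 'I_a -> int) (c : 'I_b -> int) (s : 'I_n -> int) A B :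
  mxhomog r c A -> mxzpart r s (A *m B) = A *m mxzpart c s B.
Proof.
move=> hA; apply/matrixP => j k; rewrite !mxE zpart_sum; apply: eq_bigr => l _.
by rewrite mxE -(zpartMl _ _ (hA j l)) addrA subrK.
Qed.

(** All differentials being homogeneous, the degree 0 part of a chain map that
covers a homogeneous element is again one. *)
Lemma chain_map_zpart J d f F G shF shG phi :
  (forall e p, J p -> J (zpart e p)) -> zhomog d f -> @graded K N F shF ->
  @graded K N G shG -> @chain_map K N J f F G phi ->
  @chain_map K N J f F G (fun i => mxzpart (fun j => shF i j + d) (shG i) (phi i)).
Proof.
move=> zJ hf [augF difF] [augG difG] [phi0 phiS]; split=> [j|i]; last first.
  have hdG : mxhomog (shG i.+1) (shG i) (dif G i) by [].
  have hdF : mxhomog (fun j => shF i.+1 j + d) (fun j => shF i j + d) (dif F i).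
    by move=> j k; rewrite opprD addrACA subrr addr0; apply: difF.
  by rewrite -(mxzpartMr _ _ hdG) phiS (mxzpartMl _ _ hdF).
have hG : mxhomog (shG 0%N) (fun=> 0) (aug G).
  by move=> k l; rewrite subr0 ord1; apply: augG.
have hF : mxhomog (fun j => shF 0%N j + d) (fun=> 0) (f *: aug F).
  move=> k l; rewrite mxE subr0 addrC ord1 -(zpart_id (augF k)) -(zpartMl _ _ hf).
  exact: zhomog_zpart.
rewrite -(mxzpartMr _ _ hG) -[f *: aug F](mxzpart_id hF) -mxzpartB mxE.
exact/zJ/phi0.
Qed.

Lemma zhomog_dhomog n p : zhomog n%:Z p -> p \is n.-homog.
Proof. by move=> H; apply/dhomogP => m /H[]. Qed.

Lemma graded_minimal F (sh : nat -> int) : @graded K N F (fun i _ => sh i) ->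
  (forall i, sh i.+1 != sh i) -> minimal F.
Proof. by move=> [_ difF] shN i j k; apply: (zhomog_coef0 (difF i j k)); rewrite subr_eq0. Qed.

(** Between minimal resolutions the reduced comparison maps are invertible, so
each row of a graded one has a nonzero constant entry, and such an entry only
relates generators of the same degree. *)
Lemma minimal_shift_unique I F G shF (sh : nat -> int) : is_ideal I ->
  (forall e p, I p -> I (zpart e p)) ->
  minimal_graded_resolution I shF ->
  @minimal_graded_resolution K N I G (fun i _ => sh i) ->
  forall i (j : 'I_(rk F i.+1)), shF i.+1 j = sh i.+1.
Proof.
move=> idI zI [resF grF minF] [resG grG minG] i j.
have [phi cphi] := chain_map_id idI resF resG.
have [psi cpsi] := chain_map_id idI resG resF.
have hom1 : zhomog 0 (1 : R) by have := @zhomogX 0%MM; rewrite mdeg0 mpolyX0.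
have := chain_map_zpart zI hom1 grF grG cphi.
set chi := fun i => _ => cchi.
have := bar_roundtrip_minimal idI minF resF resG cchi cpsi i.
move=> /matrixP/(_ j j); rewrite !mxE eqxx => sum1.
have [k] : exists k, bar (chi i.+1) j k != 0.
  apply/existsP; apply: contraT; rewrite negb_exists => /forallP H.
  move: sum1; rewrite big1 => [/eqP|k _]; first by rewrite eq_sym oner_eq0.
  by have := H k; rewrite negbK => /eqP ->; rewrite mul0r.
apply: contraNeq => ne; rewrite mxE; apply/eqP.
apply: (@zhomog_coef0 (shF i.+1 j + 0 - sh i.+1)).
  exact: (mxzpart_homog (r := fun j => shF i.+1 j + 0)).
by rewrite addr0 subr_eq0.
Qed.

(** * Linear resolutions and mapping cones *)

Definition lin_shift (d i : nat) : int := if i is i'.+1 then (i' + d)%N%:Z else 0.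

(** The differentials after the first are matrices of linear forms. When d > 0
the degrees increase strictly, so that such a resolution is minimal. *)
Definition linear_resolution (d : nat) I (b : nat -> nat) : Prop :=
  exists F, [/\ free_resolution I F, @graded K N F (fun i _ => lin_shift d i)
    & forall i, rk F i = b i].

Lemma free_resolution_iff I J F : (forall p, I p <-> J p) ->
  free_resolution I F -> free_resolution J F.
Proof.
move=> IJ [H1 H2 H3]; split=> // [f|v]; last by rewrite -IJ.
by have [v /IJ] := H1 f; exists v.
Qed.

Lemma eq_linear_resolution (d : nat) I J b b' : (forall p, I p <-> J p) -> b =1 b' ->
  linear_resolution d I b -> linear_resolution d J b'.
Proof.
move=> IJ bb' [F [resF grF rkF]]; exists F; split=> // [|i]; last by rewrite rkF.
exact: free_resolution_iff resF.
Qed.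

Lemma linear_resolution0 (d : nat) : linear_resolution d (fun p => p = 0) (fun i => (i == 0)%N).
Proof.
exists (@FreeComplex K N (fun i => nat_of_bool (i == 0)%N) (fun i => 0) 1%:M).
split=> //; last first.
  split=> [j|i []//]; apply/zhomogP => m; rewrite mxE ord1 eqxx mcoeff1 /=.
  by case: (m =P 0%MM) => [->|_]; rewrite ?mdeg0 ?eqxx.
split=> /= [f|v|i v].
- by exists f%:M; rewrite mulmx1 mxE eqxx subrr.
- rewrite mulmx1; split=> [v0|[w ->]]; last by rewrite mulmx0 mxE.
  by exists 0; rewrite mulmx0; apply/rowP => k; rewrite mxE ord1.
- split=> _; last by rewrite mulmx0.
  by exists 0; apply/rowP; case.
Qed.

Section Cone.

Context (C F : free_complex K N) (phi : forall i, 'M[R]_(rk C i, rk F i)).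

Definition cone_rk i := if i is i'.+1 then (rk F i'.+1 + rk C i')%N else rk F 0.

Definition cone_dif i : 'M[R]_(cone_rk i.+1, cone_rk i) :=
  match i return 'M[R]_(cone_rk i.+1, cone_rk i) with
  | 0 => col_mx (dif F 0) (phi 0)
  | i'.+1 => block_mx (dif F i'.+1) 0 (phi i'.+1) (- dif C i')
  end.

Definition cone : free_complex K N := @FreeComplex K N cone_rk cone_dif (aug F).

(** Here A = J : f and L = J + (f). Multiplication by [f] embeds R/A into R/J
with cokernel R/L, so the cone of a lift of it resolves R/L. *)
Lemma cone_resolution (A J L : R -> Prop) f : is_ideal J ->
  (forall g, A g <-> J (g * f)) -> (forall h, L h <-> exists g, J (h - g * f)) ->
  free_resolution A C -> free_resolution J F -> chain_map J f phi ->
  free_resolution L cone.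
Proof.
move=> idJ AJ LJ resC resF [phi0 phiS].
have [J0 JD JM] := idJ.
have [surjF exF0 exF] := resF; have [surjC exC0 exC] := resC.
(* v *m phi 0 is, modulo J, f times the element of R/A that v represents *)
have phi0v (v : 'rV_(rk C 0)) :
    J ((v *m phi 0 *m aug F) 0 0 - (v *m aug C) 0 0 * f).
  have -> : (v *m phi 0 *m aug F) 0 0 - (v *m aug C) 0 0 * f
      = (v *m (phi 0 *m aug F - f *: aug C)) 0 0.
    rewrite mulmxBr -scalemxAr mulmxA [RHS]mxE [X in _ = _ + X]mxE.
    by rewrite [X in _ = _ - X]mxE (mulrC f).
  by apply: ideal_mulmx => // l k; rewrite ord1.
have row_split a b (v : 'rV[R]_(a + b)) : v = row_mx (lsubmx v) (rsubmx v).
  by rewrite hsubmxK.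
split=> [h|v|[|i] v] /=.
- have [v Jv] := surjF h; exists v; apply/LJ; exists 0.
  by rewrite mul0r subr0.
- rewrite LJ; split=> [[g Jg]|[w ->]].
    have [u Au] := surjC g.
    have : J (((v - u *m phi 0) *m aug F) 0 0).
      have -> : ((v - u *m phi 0) *m aug F) 0 0
         = ((v *m aug F) 0 0 - g * f) + (g - (u *m aug C) 0 0) * f
           - ((u *m phi 0 *m aug F) 0 0 - (u *m aug C) 0 0 * f).
        rewrite mulmxBl mxE [X in _ + X = _]mxE mulrBl addrA subrK.
        by rewrite opprB addrA subrK.
      by apply: idealB => //; apply: JD => //; apply/AJ.
    move=> /exF0[w vE]; exists (row_mx w u).
    by rewrite mul_row_col -vE subrK.
  rewrite [w]row_split mul_row_col mulmxDl.
  exists ((rsubmx w *m aug C) 0 0); rewrite mxE -addrA.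
  apply: JD => //; apply/exF0; by exists (lsubmx w).
- rewrite [v]row_split mul_row_col; split=> [v0|[w vE]]; last first.
    rewrite [w]row_split mul_row_block mulmx0 add0r in vE.
    have [-> ->] := eq_row_mx vE.
    rewrite mulmxDl -!mulmxA (dif_dif resF) mulmx0 add0r phiS.
    by rewrite mulNmx mulmxN subrr.
  have : A ((rsubmx v *m aug C) 0 0).
    apply/AJ; rewrite -(subKr ((rsubmx v *m phi 0 *m aug F) 0 0) (_ * f)).
    apply: idealB => //; have /eqP := v0; rewrite addrC addr_eq0 => /eqP ->.
    by rewrite mulNmx mxE -mulN1r; apply: JM; apply/exF0; exists (lsubmx v).
  move=> /exC0[w2 w2E]; have : (lsubmx v + w2 *m phi 1) *m dif F 0 = 0.
    by rewrite mulmxDl -mulmxA phiS mulmxA -w2E.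
  move=> /exF[w1 w1E]; exists (row_mx w1 (- w2)).
  by rewrite mul_row_block mulmx0 add0r mulmxN !mulNmx opprK -w1E -w2E addrK.
- rewrite [v]row_split mul_row_block mulmx0 add0r.
  split=> [v0|[w vE]]; last first.
    rewrite [w]row_split mul_row_block mulmx0 add0r in vE.
    have [-> ->] := eq_row_mx vE.
    rewrite mulmxDl -!mulmxA (dif_dif resF) mulmx0 add0r phiS.
    by rewrite !mulNmx !mulmxN opprK (dif_dif resC) mulmx0 subrr row_mx0.
  have [v1 /eqP] := eq_row_mx (etrans v0 (esym (row_mx0 _ _ _ _))).
  rewrite mulmxN oppr_eq0 => /eqP /exC[w2 w2E].
  have : (lsubmx v + w2 *m phi i.+2) *m dif F i.+1 = 0.
    by rewrite mulmxDl -mulmxA phiS mulmxA -w2E.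
  move=> /exF[w1 w1E]; exists (row_mx w1 (- w2)).
  by rewrite mul_row_block mulmx0 add0r mulmxN !mulNmx opprK -w1E -w2E addrK.
Qed.

Lemma cone_graded (d : nat) : (0 < d)%N ->
  @graded K N F (fun i _ => lin_shift d i) ->
  @graded K N C (fun i _ => lin_shift 1 i) ->
  (forall i j k, zhomog (lin_shift 1 i + d%:Z - lin_shift d i) (phi i j k)) ->
  @graded K N cone (fun i _ => lin_shift d i).
Proof.
have lin1 i : lin_shift 1 i = i by case: i => //= i; rewrite addn1.
move=> d_gt0 [augF difF] [_ difC] hphi; split=> // -[|i] j k /=.
  rewrite mxE; case: splitP => l _; first exact: difF.
  by have := hphi 0%N l k; rewrite /= add0r add0n subr0.
have phi_shift : lin_shift d i.+2 - lin_shift d i.+1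
    = lin_shift 1 i.+1 + d%:Z - lin_shift d i.+1 by rewrite lin1 -PoszD.
have dif_shift : lin_shift d i.+2 - lin_shift d i.+1
    = lin_shift 1 i.+1 - lin_shift 1 i.
  by rewrite !lin1 /= addSn -addn1 -(addn1 i) !PoszD; rewrite addrAC subrr [RHS]addrAC subrr.
rewrite mxE; case: splitP => l _; rewrite mxE; case: splitP => l' _.
- exact: difF.
- by rewrite mxE; apply: zhomog0.
- by rewrite phi_shift; apply: hphi.
- by rewrite mxE dif_shift; apply/zhomogN/difC.
Qed.

End Cone.

(** The mapping cone of multiplication by the monomial [w] of degree [d]. Twisted
by [d], the resolution of the colon ideal has its i-th generators in degree
i + d, which is where the (i + 1)-st generators of a linear resolution of J sit,
so linearity is preserved. *)
Lemma linear_resolution_adjoin (d : nat) (P : pred 'X_{1..N}) w bJ bA : (0 < d)%N ->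
  upset P -> mdeg w = d ->
  linear_resolution d (mon_ideal P) bJ ->
  linear_resolution 1 (mon_ideal (fun m => P (m + w)%MM)) bA ->
  linear_resolution d (mon_ideal (fun m => P m || (w <= m)%MM))
    (fun i => if i is i'.+1 then (bJ i + bA i')%N else bJ 0%N).
Proof.
move=> d_gt0 uP wd [F [resF grF rkF]] [C [resC grC rkC]].
have idJ := mon_ideal_is_ideal K uP.
have AJ (g : R) : mon_ideal (fun m => P (m + w)%MM) g <-> mon_ideal P (g * 'X_[w]).
  by rewrite mon_ideal_colon.
have [|phi0 cphi0] := chain_map_lift (f := 'X_[w]) idJ resC resF.
  by move=> g; rewrite AJ mulrC.
have hw : zhomog d ('X_[w] : R) by rewrite -wd; apply: zhomogX.
pose phi i := mxzpart (fun=> lin_shift 1 i + d%:Z) (fun=> lin_shift d i) (phi0 i).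
have cphi : chain_map (mon_ideal P) 'X_[w] phi.
  by apply: (chain_map_zpart _ hw grC grF cphi0) => e p; apply: mon_ideal_mpart.
exists (cone phi); split.
- exact: (cone_resolution idJ AJ (fun h => mon_ideal_adjoin _ _ uP) resC resF cphi).
- apply: cone_graded => // i j k.
  exact: (mxzpart_homog (r := fun=> lin_shift 1 i + d%:Z) (c := fun=> lin_shift d i)).
- by case=> [|i] /=; rewrite ?rkF ?rkC.
Qed.

End Graded.

(** * Ferrers ideals as monomial ideals *)

Section Ferrers.

Context (K : fieldType) (n m : nat) (l : nat -> nat).
Context (l_anti : forall i j, (i <= j)%N -> (l j <= l i)%N).
Context (l_le : forall i, (l i <= m)%N).
Local Notation N := (n + m)%N.
Implicit Types (u : 'X_{1..N}).

Definition var_idx a b : seq 'I_N :=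
  [seq lshift m i | i : 'I_n <- enum 'I_n & (i < a)%N] ++
  [seq rshift n j | j : 'I_m <- enum 'I_m & (j < b)%N].

Lemma var_gensE a b : var_gens K n m a b = [seq 'X_i | i <- var_idx a b].
Proof. by rewrite map_cat -!map_comp. Qed.

Lemma mem_var_idx_x a b i : (lshift m i \in var_idx a b) = (i < a)%N.
Proof.
rewrite mem_cat mem_map; last exact: lshift_inj.
rewrite mem_filter mem_enum andbT orbC; case: mapP => // -[j _ /eqP].
by rewrite eq_lrshift.
Qed.

Lemma mem_var_idx_y a b j : (rshift n j \in var_idx a b) = (j < b)%N.
Proof.
rewrite mem_cat orbC mem_map; last exact: rshift_inj.
rewrite mem_filter mem_enum andbT orbC; case: mapP => // -[i _ /eqP].
by rewrite eq_rlshift.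
Qed.

Lemma uniq_var_idx a b : uniq (var_idx a b).
Proof.
rewrite cat_uniq; apply/and3P; split.
- rewrite map_inj_uniq; [by rewrite filter_uniq ?enum_uniq | exact: lshift_inj].
- apply/hasPn => _ /mapP[j _ ->]; apply/mapP => -[i _ /eqP].
  by rewrite eq_rlshift.
- rewrite map_inj_uniq; [by rewrite filter_uniq ?enum_uniq | exact: rshift_inj].
Qed.

Lemma size_var_idx a b : (a <= n)%N -> (b <= m)%N -> size (var_idx a b) = (a + b)%N.
Proof.
have size_lt c k : (c <= k)%N -> size [seq i : 'I_k <- enum 'I_k | (i < c)%N] = c.
  move=> le_ck; rewrite size_filter -sum1_count big_enum_cond /=.
  by rewrite -(big_ord_widen _ (fun=> 1%N) le_ck) sum1_card card_ord.
by move=> le_an le_bm; rewrite size_cat !size_map !size_lt.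
Qed.

Lemma vars_predP a b u : reflect
  ((exists2 i : 'I_n, (i < a)%N & u (lshift m i) != 0%N) \/
   (exists2 j : 'I_m, (j < b)%N & u (rshift n j) != 0%N))
  (vars_pred (var_idx a b) u).
Proof.
apply: (iffP hasP) => [[k]|[] [i lt_i ui]].
- rewrite mem_cat => /orP[] /mapP[i]; rewrite mem_filter => /andP[lt_i _ ->] ui;
    by [left; exists i | right; exists i].
- by exists (lshift m i); rewrite ?mem_var_idx_x.
- by exists (rshift n i); rewrite ?mem_var_idx_y.
Qed.

(** These sets filter the Ferrers ideal by its generators x_i y_j, taken in the
lexicographic order of the pairs (i, j). *)
Definition ferrers_pred a b : pred 'X_{1..N} := fun u =>
  [exists i : 'I_n, exists j : 'I_m, [&& (j < l i)%N,
    (i < a)%N || (i == a :> nat) && (j < b)%N,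
    u (lshift m i) != 0%N & u (rshift n j) != 0%N]].

Lemma ferrers_predP a b u : reflect
  (exists i : 'I_n, exists j : 'I_m, [/\ (j < l i)%N,
    (i < a)%N || (i == a :> nat) && (j < b)%N,
    u (lshift m i) != 0%N & u (rshift n j) != 0%N])
  (ferrers_pred a b u).
Proof.
apply: (iffP existsP) => -[i]; first by move=> /existsP[j /and4P H]; exists i, j.
by move=> [j H]; exists i; apply/existsP; exists j; apply/and4P.
Qed.

Lemma upset_ferrers a b : upset (ferrers_pred a b).
Proof.
move=> u u' /ferrers_predP[i [j [lj ij ui uj]]]; apply/ferrers_predP; exists i, j.
by split=> //; rewrite mnmDE addn_eq0 negb_and ?ui ?uj.
Qed.

Definition edge_mon (i : 'I_n) (j : 'I_m) : 'X_{1..N} :=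
  (U_(lshift m i) + U_(rshift n j))%MM.

Lemma edge_mon_x i j k : edge_mon i j (lshift m k) = (i == k).
Proof. by rewrite mnmDE !mnm1E eq_lshift eq_rlshift addn0. Qed.

Lemma edge_mon_y i j k : edge_mon i j (rshift n k) = (j == k).
Proof. by rewrite mnmDE !mnm1E eq_rshift eq_lrshift. Qed.

Lemma add_edge_x u i j k : (u + edge_mon i j)%MM (lshift m k) = (u (lshift m k) + (i == k))%N.
Proof. by rewrite mnmDE edge_mon_x. Qed.

Lemma add_edge_y u i j k : (u + edge_mon i j)%MM (rshift n k) = (u (rshift n k) + (j == k))%N.
Proof. by rewrite mnmDE edge_mon_y. Qed.

Lemma edge_mon_le i j u :
  (edge_mon i j <= u)%MM = (u (lshift m i) != 0%N) && (u (rshift n j) != 0%N).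
Proof.
apply/mnm_lepP/andP => [H|[ui uj] k].
  have := H (lshift m i); have := H (rshift n j).
  by rewrite edge_mon_x edge_mon_y !eqxx !lt0n.
case: (split_ordP k) => k' ->; rewrite ?edge_mon_x ?edge_mon_y.
  by case: eqP => // <-; rewrite lt0n.
by case: eqP => // <-; rewrite lt0n.
Qed.

Lemma ferrers_pred_step (a : 'I_n) (b : 'I_m) : (b < l a)%N ->
  ferrers_pred a b.+1 =1 (fun u => ferrers_pred a b u || (edge_mon a b <= u)%MM).
Proof.
move=> b_lt u; rewrite edge_mon_le; apply/ferrers_predP/orP; last first.
  case=> [/ferrers_predP[i [j [lj ij ui uj]]]|/andP[ua ub]].
    exists i, j; split=> //; case/orP: ij => [->//|/andP[-> lt_jb]].
    by rewrite ltnS (ltnW lt_jb) orbT.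
  by exists a, b; rewrite eqxx ltnSn orbT.
move=> [i [j [lj ij ui uj]]]; case/orP: ij => [lt_ia|/andP[/eqP ia]].
  by left; apply/ferrers_predP; exists i, j; rewrite lt_ia.
rewrite ltnS leq_eqVlt => /orP[/eqP jb|lt_jb].
  by right; rewrite -(ord_inj ia) -(ord_inj jb) ui.
by left; apply/ferrers_predP; exists i, j; split=> //; rewrite ia eqxx lt_jb orbT.
Qed.

(** The colon ideal of the earlier generators by x_a y_b: an earlier x_i y_j
contributes x_i through x_i y_b if i < a, and otherwise y_j. *)
Lemma ferrers_pred_colon (a : 'I_n) (b : 'I_m) : (b < l a)%N ->
  (fun u => ferrers_pred a b (u + edge_mon a b)%MM) =1 vars_pred (var_idx a b).
Proof.
move=> b_lt u; apply/ferrers_predP/vars_predP.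
  move=> [i [j [lj ij]]]; rewrite add_edge_x add_edge_y => ui uj.
  case/orP: ij => [lt_ia|/andP[/eqP ia lt_jb]]; [left; exists i|right; exists j] => //.
    by move: ui; rewrite -[a == i]val_eqE /= (gtn_eqF lt_ia) addn0.
  by move: uj; rewrite -[b == j]val_eqE /= (gtn_eqF lt_jb) addn0.
case=> [[i lt_ia ui]|[j lt_jb uj]].
  exists i, b; rewrite lt_ia add_edge_x add_edge_y eqxx addn1; split=> //.
    by rewrite (leq_trans b_lt) // l_anti // ltnW.
  by rewrite addn_eq0 negb_and ui.
exists a, j; split; rewrite ?add_edge_x ?add_edge_y ?eqxx ?lt_jb ?orbT //.
- exact: ltn_trans lt_jb b_lt.
- by rewrite addn1.
- by rewrite addn_eq0 negb_and uj.
Qed.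

Lemma ferrers_pred0 u : ferrers_pred 0 0 u = false.
Proof. by apply/ferrers_predP => -[i [j [_]]]; rewrite !ltn0 andbF. Qed.

Lemma ferrers_pred_row a : ferrers_pred a (l a) =1 ferrers_pred a.+1 0.
Proof.
move=> u; apply/ferrers_predP/ferrers_predP => -[i [j [lj ij ui uj]]];
  exists i, j; split=> //.
- rewrite ltnS; case/orP: ij => [/ltnW->//|/andP[/eqP-> _]]; by rewrite leqnn.
- move: ij; rewrite ltn0 andbF orbF ltnS leq_eqVlt => /orP[/eqP ia|->//].
  by rewrite -ia lj eqxx orbT.
Qed.

(** The Koszul complex, as iterated mapping cones: a new variable is not a zero
divisor modulo the others, that is, its colon ideal is the ideal itself. *)
Lemma koszul_resolution (S : seq 'I_N) : uniq S ->
  @linear_resolution K N 1 (mon_ideal (vars_pred S)) (fun k => 'C(size S, k)).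
Proof.
elim: S => [|i S IH] /= => [_|/andP[iS uS]].
  apply: eq_linear_resolution (linear_resolution0 K N 1) => [p|k]; last first.
    by case: k.
  split=> [->|/mon_idealP H]; first exact: mon_ideal0.
  by apply/mpolyP => u; rewrite mcoeff0; apply/eqP/negPn/negP => /H.
have colon : (fun u => vars_pred S (u + U_(i))%MM) =1 vars_pred S.
  move=> u; apply: eq_in_has => k kS; rewrite mnmDE mnm1E.
  by case: (i =P k) => [ik|_]; [rewrite ik kS in iS | rewrite addn0].
have := linear_resolution_adjoin (d := 1) isT (@upset_vars N S) (mdeg1 i) (IH uS).
move=> /(_ (fun k => 'C(size S, k)))[|F HF].
  by apply: eq_linear_resolution (IH uS) => // p; rewrite (eq_mon_ideal colon).
apply: (@eq_linear_resolution _ _ _ _ _ _ _ _ _ (ex_intro _ F HF)) => [p|[|k]].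
- rewrite (eq_mon_ideal (P' := vars_pred (i :: S))) // => u /=.
  by rewrite lep1mP orbC.
- by rewrite !bin0.
- by rewrite binS.
Qed.

(** Each generator x_i y_j contributes the Koszul complex on the i + j variables
of its colon ideal, shifted by one. *)
Definition ferrers_betti a b k :=
  if k is k'.+1
  then (\sum_(i < a) \sum_(j < l i) 'C(i + j, k') + \sum_(j < b) 'C(a + j, k'))%N
  else 1%N.

(** The generators taken in lexicographic order have linear quotients. *)
Lemma ferrers_resolution_step a b : (a < n)%N -> (b < l a)%N ->
  @linear_resolution K N 2 (mon_ideal (ferrers_pred a b)) (ferrers_betti a b) ->
  @linear_resolution K N 2 (mon_ideal (ferrers_pred a b.+1)) (ferrers_betti a b.+1).
Proof.
move=> lt_an lt_b linJ.
have lt_bm := leq_trans lt_b (l_le a).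
pose a' := Ordinal lt_an; pose b' := Ordinal lt_bm.
have deg2 : mdeg (edge_mon a' b') = 2%N by rewrite mdegD !mdeg1.
have linA := koszul_resolution (uniq_var_idx a b).
rewrite size_var_idx ?(ltnW lt_an) ?(ltnW lt_bm) // in linA.
have [|F HF] := linear_resolution_adjoin (d := 2) isT (@upset_ferrers a b) deg2 linJ
                  (bA := fun k => 'C(a + b, k)).
  apply: eq_linear_resolution linA => // p.
  by rewrite -(eq_mon_ideal (@ferrers_pred_colon a' b' lt_b)).
apply: eq_linear_resolution (ex_intro _ F HF) => [p|[|k]] //.
  by rewrite -(eq_mon_ideal (@ferrers_pred_step a' b' lt_b)).
by rewrite /= big_ord_recr addnA.
Qed.

(** Adjoining the generators one at a time, each colon ideal is generated by
variables: the ideal has linear quotients. *)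
Lemma ferrers_resolution a : (a <= n)%N ->
  @linear_resolution K N 2 (mon_ideal (ferrers_pred a 0)) (ferrers_betti a 0).
Proof.
elim: a => [_|a IHa lt_an].
  apply: eq_linear_resolution (linear_resolution0 K N 2) => [p|[|k]] //; last first.
    by rewrite /= !big_ord0.
  split=> [->|/mon_idealP H]; first exact: mon_ideal0.
  by apply/mpolyP => u; rewrite mcoeff0; apply/eqP/negPn/negP => /H; rewrite ferrers_pred0.
have row b : (b <= l a)%N ->
    @linear_resolution K N 2 (mon_ideal (ferrers_pred a b)) (ferrers_betti a b).
  elim: b => [_|b IHb lt_b]; first exact/IHa/ltnW.
  exact/ferrers_resolution_step/IHb/ltnW.
apply: eq_linear_resolution (row _ (leqnn (l a))) => [p|[|k]] //=.
  by rewrite (eq_mon_ideal (ferrers_pred_row a)).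
by rewrite big_ord_recr /= [in RHS]big_ord0 addn0.
Qed.

End Ferrers.

(** * Betti numbers *)

Section LinearBetti.

Context (K : fieldType) (N : nat).
Implicit Types (I : {mpoly K[N]} -> Prop).

Lemma lin_shift_neq d i : (0 < d)%N -> lin_shift d i.+1 != lin_shift d i.
Proof.
by move=> d_gt0; case: i => [|i]; rewrite /= eqz_nat gtn_eqF.
Qed.

Lemma linear_resolution_betti d I b i : (0 < d)%N -> is_ideal I ->
  linear_resolution d I b -> betti I i.+1 (b i.+1).
Proof.
move=> d_gt0 idI [F [resF grF <-]]; apply: betti_minimal => //.
by apply: graded_minimal grF _ => j; apply: lin_shift_neq.
Qed.

Lemma linear_resolution_two_linear I b : is_ideal I ->
  (forall e p, I p -> I (zpart e p)) -> linear_resolution 2 I b ->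
  has_two_linear_resolution I.
Proof.
move=> idI zI [F [resF grF _]].
have minrF : @minimal_graded_resolution K N I F (fun i _ => lin_shift 2 i).
  by split=> //; apply: graded_minimal grF _ => i; apply: lin_shift_neq.
split; first by exists F, (fun i _ => lin_shift 2 i).
move=> G sh minrG; have shE := minimal_shift_unique idI zI minrG minrF.
split=> [j|i j k]; first exact: shE.
have [_ [_ difG] _] := minrG; apply: zhomog_dhomog.
by have := difG i.+1 j k; rewrite !shE /= addSn -addn1 PoszD addrAC subrr add0r.
Qed.

End LinearBetti.

Lemma sum_bin_column a L k :
  (\sum_(j < L) 'C(a + j, k) + 'C(a, k.+1) = 'C(a + L, k.+1))%N.
Proof.
elim: L => [|L IH]; first by rewrite big_ord0 addn0.
by rewrite big_ord_recr /= addnAC IH addnS binS.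
Qed.

(** Row j sums to C(l_j + j, k + 1) - C(j, k + 1), and the subtracted terms add up
to C(n, k + 2); both are sums down a column of Pascal's triangle. *)
Lemma ferrers_bettiE n (l : nat -> nat) k :
  (ferrers_betti l n 0 k.+1)%:Z
  = \sum_(j < n) 'C(l j + j, k.+1)%:Z - 'C(n, k.+2)%:Z.
Proof.
rewrite /= big_ord0 addn0; apply/eqP; rewrite eq_sym subr_eq; apply/eqP.
rewrite -(sum_bin_column 0 n k.+1) bin0n addn0 -!PoszD -natz.
under eq_bigr do rewrite -natz.
rewrite -natr_sum; congr _%:R.
rewrite -big_split /=; apply: eq_bigr => j _.
by rewrite addnC -sum_bin_column.
Qed.

(** * Primary decomposition *)

Lemma is_partition_anti lam i j : is_partition lam -> (i <= j)%N ->
  (nth 0 lam j <= nth 0 lam i)%N.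
Proof.
move=> /andP[srt _] le_ij; have [lt_j|le_j] := ltnP j (size lam); last by rewrite nth_default.
apply: (sorted_leq_nth (leT := geq)) => //.
- by move=> y x z /= le_yx le_zy; apply: leq_trans le_zy le_yx.
- by move=> x /=.
- exact: leq_ltn_trans lt_j.
Qed.

Lemma is_partition_le_head lam i : is_partition lam -> (nth 0 lam i <= head 0 lam)%N.
Proof. by rewrite -nth0 => /is_partition_anti; apply. Qed.

Lemma is_partition_gt0 lam i : is_partition lam -> (i < size lam)%N -> (0 < nth 0 lam i)%N.
Proof. by move=> /andP[_ /allP pos] lt_i; apply/pos/mem_nth. Qed.

Lemma ltn_count_ge2 lam i : is_partition lam ->
  (i < count (leq 2) lam)%N = (2 <= nth 0 lam i)%N.
Proof.
elim: lam i => [|x lam IH] i part; first by rewrite nth_nil ltn0.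
have part' : is_partition lam.
  by case/andP: part => /= srt /andP[_ pos]; rewrite /is_partition (path_sorted srt) pos.
rewrite /=; case: (leqP 2 x) => [x_ge2|x_lt2].
  by case: i => [|i] //=; rewrite add1n ltnS IH.
have cnt0 : count (leq 2) lam = 0%N.
  apply/eqP; rewrite -leqn0 leqNgt IH // -leqNgt.
  exact: leq_trans (is_partition_anti (j := 1) part (leq0n 1)) x_lt2.
by rewrite add0n cnt0 ltn0; apply/esym/negbTE; rewrite -ltnNge (leq_trans _ x_lt2) // ltnS
  (is_partition_anti (i := 0)).
Qed.

Section PrimaryDecomposition.

Context (n m : nat) (l : nat -> nat) (s : nat).
Context (l_anti : forall i j, (i <= j)%N -> (l j <= l i)%N).
Context (l_gt0 : forall i, (i < n)%N -> (0 < l i)%N).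
Context (l_ge2 : forall i, (i < s)%N = (2 <= l i)%N).

(** With indices from 1: a monomial in every component involves some x_i; at the
least such i, the i-th component, or (x_1, ..., x_s, y_1) when s < i, provides
the y_j of an edge. *)
Lemma ferrers_pred_components (u : 'X_{1..n + m}) :
  ferrers_pred l n 0 u <->
  [/\ forall i, (i < s)%N -> vars_pred (var_idx n m i (l i)) u,
      vars_pred (var_idx n m s 1) u & vars_pred (var_idx n m n 0) u].
Proof.
split=> [/ferrers_predP[i [j [lj _ ui uj]]]|[comp_i comp_s comp_n]].
  split=> [a _||]; last by apply/vars_predP; left; exists i.
    apply/vars_predP; have [lt_ia|le_ai] := ltnP i a; [by left; exists i | right].
    by exists j => //; apply: leq_trans lj (l_anti le_ai).
  apply/vars_predP; have [lt_is|] := boolP (i < s)%N; first by left; exists i.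
  by rewrite l_ge2 -ltnNge => l_lt2; right; exists j => //; apply: leq_trans lj _.
have [i0 ui0] : exists i : 'I_n, u (lshift m i) != 0%N.
  by case/vars_predP: comp_n => -[i //]; exists i.
pose a := [arg min_(i < i0 | u (lshift m i) != 0%N) i].
have [ua a_min] : u (lshift m a) != 0%N /\
    forall i : 'I_n, u (lshift m i) != 0%N -> (a <= i)%N.
  by rewrite /a; case: arg_minnP.
have [j lj uj] : exists2 j : 'I_m, (j < l a)%N & u (rshift n j) != 0%N.
  have [lt_as|le_sa] := ltnP a s.
    case/vars_predP: (comp_i a lt_as) => -[i lt_i ui]; last by exists i.
    by have := a_min i ui; rewrite leqNgt lt_i.
  case/vars_predP: comp_s => -[i lt_i ui].
    by have := leq_trans (leq_trans lt_i le_sa) (a_min i ui); rewrite ltnn.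
  by exists i => //; apply: leq_trans lt_i (l_gt0 _).
by apply/ferrers_predP; exists a, j; rewrite ltn_ord.
Qed.

End PrimaryDecomposition.

Lemma ferrers_idealE (K : fieldType) lam f :
  ferrers_ideal K lam f <-> mon_ideal (ferrers_pred (nth 0%N lam) (size lam) 0) f.
Proof.
pose us := [seq edge_mon p.1 p.2
  | p : 'I_(size lam) * 'I_(head 0%N lam) <- enum predT & (p.2 < nth 0%N lam p.1)%N].
have gensE : ferrers_gens K lam = [seq 'X_[u] | u <- us].
  by rewrite -map_comp; apply: eq_map => p; rewrite /= mpolyXD.
rewrite /ferrers_ideal gensE gen_ideal_mon.
rewrite (eq_mon_ideal (P' := ferrers_pred (nth 0%N lam) (size lam) 0)) // => u.
apply/hasP/ferrers_predP => [[v /mapP[p p_in ->]]|[i [j [lj _ ui uj]]]].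
  move: p_in; rewrite mem_filter => /andP[lj _]; rewrite edge_mon_le => /andP[ui uj].
  by exists p.1, p.2; rewrite ltn_ord.
exists (edge_mon i j); last by rewrite edge_mon_le ui.
by apply/mapP; exists (i, j); rewrite // mem_filter lj mem_enum.
Qed.

Lemma ferrers_primary_decomposition (K : fieldType) lam : is_partition lam ->
  let n := size lam in let m := head 0%N lam in let s := count (leq 2) lam in
  primary_decomposition (ferrers_ideal K lam)
    ([seq var_gens K n m i (nth 0%N lam i) | i <- iota 0 s]
       ++ [:: var_gens K n m s 1; var_gens K n m n 0]).
Proof.
move=> part n m s; split=> [G|f].
  rewrite mem_cat !inE => /or3P[/mapP[i _ ->]|/eqP->|/eqP->];
    rewrite var_gensE; exact: gen_ideal_vars_prime.
have compE u := @ferrers_pred_components n m (nth 0%N lam) s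
  (fun i j => is_partition_anti part) (fun i => is_partition_gt0 part)
  (fun i => ltn_count_ge2 i part) u.
rewrite ferrers_idealE; split=> [/mon_idealP If G|H].
  rewrite mem_cat !inE => /or3P[/mapP[i lt_is ->]|/eqP->|/eqP->];
    rewrite var_gensE gen_ideal_vars; apply/mon_idealP => u /If /compE[comp_i ? ?] //.
  by apply: comp_i; rewrite mem_iota in lt_is.
have {}H a b : var_gens K n m a b \in
   [seq var_gens K n m i (nth 0%N lam i) | i <- iota 0 s]
       ++ [:: var_gens K n m s 1; var_gens K n m n 0] ->
   forall u, f@_u != 0 -> vars_pred (var_idx n m a b) u.
  by move=> /H; rewrite var_gensE => /gen_ideal_vars/mon_idealP.
apply/mon_idealP => u fu; apply/compE; split=> [i lt_is||].
- apply: (H _ _ _ _ fu); rewrite mem_cat; apply/orP; left.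
  by apply/mapP; exists i; rewrite ?mem_iota.
- by apply: (H _ _ _ _ fu); rewrite mem_cat !inE eqxx orbT.
- by apply: (H _ _ _ _ fu); rewrite mem_cat !inE eqxx !orbT.
Qed.

(** * Counting monomials *)

Section CountMonomials.

Context (N : nat).
Implicit Types (u : 'X_{1..N}) (P Q : pred 'X_{1..N}) (S : seq 'I_N).

Definition deg_mons k : seq 'X_{1..N} :=
  [seq val u | u : 'X_{1..N < k.+1} <- enum {: 'X_{1..N < k.+1}} & mdeg (val u) == k].

Lemma mem_deg_mons k u : (u \in deg_mons k) = (mdeg u == k).
Proof.
apply/mapP/idP => [[v + ->]|/eqP du]; first by rewrite mem_filter => /andP[].
have lt_u : (mdeg u < k.+1)%N by rewrite du.
by exists (BMultinom lt_u); rewrite // mem_filter /= du eqxx mem_enum.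
Qed.

Lemma uniq_deg_mons k : uniq (deg_mons k).
Proof.
rewrite map_inj_uniq; last by move=> v v'; apply: val_inj.
by apply: filter_uniq; apply: enum_uniq.
Qed.

Definition mon_count P k : nat := count P (deg_mons k).

Lemma eq_mon_count P Q k : P =1 Q -> mon_count P k = mon_count Q k.
Proof. by move=> PQ; apply: eq_count. Qed.

Lemma mon_count_split Q P k :
  mon_count P k = (mon_count (fun u => P u && Q u) k + mon_count (fun u => P u && ~~ Q u) k)%N.
Proof.
rewrite /mon_count; elim: (deg_mons k) => //= u s ->.
by rewrite addnACA; congr (_ + _)%N; case: (P u); case: (Q u).
Qed.

(** Multiplication by the variable of index [i] is a bijection between the two sets
of monomials. *)
Lemma mon_countS P i k :
  mon_count (fun u => P u && (u i != 0%N)) k.+1 = mon_count (fun u => P (u + U_(i))%MM) k.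
Proof.
rewrite /mon_count -!size_filter -[RHS](size_map (fun u => u + U_(i))%MM).
apply/perm_size/uniq_perm.
- by rewrite filter_uniq ?uniq_deg_mons.
- by rewrite map_inj_uniq ?filter_uniq ?uniq_deg_mons //; apply: addIm.
move=> u; rewrite mem_filter mem_deg_mons; apply/idP/mapP.
  move=> /andP[/andP[Pu ui] /eqP du]; have le_iu : (U_(i) <= u)%MM by rewrite lep1mP.
  exists (u - U_(i))%MM; last by rewrite submK.
  rewrite mem_filter submK // Pu mem_deg_mons -eqSS -du -[in X in _ == X](submK le_iu).
  by rewrite mdegD mdeg1 addn1 /=.
move=> [v + ->]; rewrite mem_filter mem_deg_mons => /andP[-> /eqP dv].
by rewrite mdegD mdeg1 dv mnmDE mnm1E !eqxx !addn1 /= eqxx.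
Qed.

Lemma mon_countX0 P i : mon_count (fun u => P u && (u i != 0%N)) 0 = 0%N.
Proof.
apply/eqP; rewrite -leqn0 leqNgt -has_count; apply/hasPn => u.
by rewrite mem_deg_mons mdeg_eq0 => /eqP ->; rewrite mnm0E andbF.
Qed.

Definition supp_in S : pred 'X_{1..N} := fun u => [forall i, (i \in S) || (u i == 0%N)].

Lemma supp_in_nil u : supp_in [::] u = (u == 0%MM).
Proof.
apply/forallP/eqP => [H|-> i]; last by rewrite mnm0E eqxx orbT.
by apply/mnmP => i; rewrite mnm0E; apply/eqP; have := H i; rewrite in_nil.
Qed.

Lemma supp_in_cons i S u : i \notin S -> supp_in (i :: S) u && (u i == 0%N) = supp_in S u.
Proof.
move=> iS; apply/andP/forallP => [[/forallP H ui] k|H].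
  by have := H k; rewrite inE; case: eqP => // -> _; rewrite ui orbT.
split; last by have := H i; rewrite (negPf iS).
by apply/forallP => k; rewrite inE -orbA H orbT.
Qed.

Lemma supp_in_add i S u : i \in S -> supp_in S (u + U_(i))%MM = supp_in S u.
Proof.
move=> iS; apply: eq_forallb => k; rewrite mnmDE mnm1E.
by case: (i =P k) => [<-|_]; rewrite ?iS // addn0.
Qed.

(** A monomial either is a multiple of the added variable, and division by it
lowers the degree by one, or does not involve it; multiplication by 1/(1-t)
obeys the same recursion. *)
Lemma mon_count_supp S k : uniq S ->
  (mon_count (supp_in S) k)%:Z = fps_exp fps_geom (size S) k.
Proof.
elim: S k => [|i S IH] k /= => [_|/andP[iS uS]].
  rewrite (eq_mon_count _ (supp_in_nil)) /mon_count /fps_poly coef1.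
  rewrite count_uniq_mem ?uniq_deg_mons // mem_deg_mons mdeg0 eq_sym.
  by case: eqP.
have geomE : forall g : fps, forall j,
    fps_mul fps_geom g j = g j + (if j is j'.+1 then fps_mul fps_geom g j' else 0).
  by move=> g [|j]; rewrite /fps_mul big_ord_recl mul1r subn0 ?big_ord0.
have restrict u : supp_in (i :: S) u && ~~ (u i != 0%N) = supp_in S u.
  by rewrite negbK supp_in_cons.
elim: k => [|k IHk]; rewrite geomE -IH // (mon_count_split (fun u => u i != 0%N)) addnC.
  by rewrite mon_countX0 addn0 addr0 (eq_mon_count _ restrict).
rewrite mon_countS (eq_mon_count _ restrict) PoszD -IHk; congr (_ + _%:Z).
by apply: eq_mon_count => u; rewrite supp_in_add ?mem_head.
Qed.

Lemma mon_count_notin S k : uniq S ->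
  (mon_count (fun u => ~~ vars_pred S u) k)%:Z = fps_exp fps_geom (N - size S) k.
Proof.
move=> uS; pose S' := [seq i <- enum 'I_N | i \notin S].
have -> : (N - size S)%N = size S'.
  have sizeS : count (mem S) (enum 'I_N) = size S.
    rewrite -size_filter; apply/perm_size/uniq_perm => // [|i].
      by rewrite filter_uniq // enum_uniq.
    by rewrite mem_filter mem_enum andbT.
  have := count_predC (mem S) (enum 'I_N); rewrite size_enum_ord sizeS size_filter.
  by move=> sizeN; rewrite -[RHS](addKn (size S)); congr (_ - _)%N; apply: esym.
rewrite -mon_count_supp; last by rewrite filter_uniq // enum_uniq.
congr _%:Z.
apply: eq_mon_count => u; apply/hasPn/forallP => H i.
  rewrite mem_filter mem_enum andbT; case: (boolP (i \in S)) => //= iS.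
  by have := H i iS; rewrite negbK.
by move=> iS; have := H i; rewrite mem_filter iS /= negbK.
Qed.

End CountMonomials.

(** * Hilbert series *)

(** The monomials outside a monomial ideal represent a basis of the quotient. *)
Lemma dim_quotient_mon (K : fieldType) (N : nat) (P : pred 'X_{1..N}) k :
  dim_quotient (fun f : {mpoly K[N]} => mon_ideal P f) k (mon_count (predC P) k).
Proof.
rewrite /mon_count -size_filter; set s := filter _ _.
have us : uniq s by rewrite filter_uniq ?uniq_deg_mons.
have sP (i : 'I_(size s)) : ~~ P (nth 0%MM s i) /\ mdeg (nth 0%MM s i) = k.
  have := mem_nth 0%MM (ltn_ord i); rewrite mem_filter mem_deg_mons.
  by move=> /andP[? /eqP].
have coef_s (c : 'I_(size s) -> K) (i : 'I_(size s)) :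
    (\sum_j c j *: 'X_[nth 0%MM s j])@_(nth 0%MM s i) = c i.
  rewrite raddf_sum (bigD1 i) //= mcoeffZ mcoeffX eqxx mulr1 big1 ?addr0 // => j ji.
  by rewrite mcoeffZ mcoeffX nth_uniq // val_eqE (negPf ji) mulr0.
exists (fun i => 'X_[nth 0%MM s i]); split=> [i|f hf|c Ic i].
- by rewrite dhomogX; apply/eqP; case: (sP i).
- exists (fun i => f@_(nth 0%MM s i)); apply/mon_idealP => u; apply: contraR => nPu.
  rewrite mcoeffB subr_eq0; apply/eqP.
  have [du|du] := eqVneq (mdeg u) k; last first.
    rewrite (dhomog_nemf_coeff hf du) raddf_sum /= big1 // => i _.
    rewrite mcoeffZ mcoeffX; case: (_ =P u) => [iu|_]; rewrite ?mulr0 //.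
    by rewrite -iu (sP i).2 eqxx in du.
  have u_s : u \in s by rewrite mem_filter /= nPu mem_deg_mons du eqxx.
  have lt_u : (index u s < size s)%N by rewrite index_mem.
  have := coef_s (fun i => f@_(nth 0%MM s i)) (Ordinal lt_u).
  by rewrite /= nth_index.
- apply/eqP; have [nPi _] := sP i; apply: contraNT nPi => ci.
  by apply: (mon_idealP _ _ Ic); rewrite coef_s.
Qed.

Section FerrersHilbert.

Context (n m : nat) (l : nat -> nat).
Context (l_anti : forall i j, (i <= j)%N -> (l j <= l i)%N).
Context (l_le : forall i, (l i <= m)%N).
Local Notation N := (n + m)%N.
Local Notation std_from a := (fun u : 'X_{1..N} =>
  ~~ ferrers_pred l n 0 u && ~~ vars_pred (var_idx n m a 0) u).

(** If x_a is the first x-variable of [u], then every edge at some x_i dividing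
[u] has its y_j adjacent to x_a, because the degrees [l] decrease. So [u] is
standard exactly when it involves no y_j adjacent to x_a. *)
Lemma std_from_first (a : 'I_n) (u : 'X_{1..N}) :
  std_from a u && (u (lshift m a) != 0%N)
  = ~~ vars_pred (var_idx n m a (l a)) u && (u (lshift m a) != 0%N).
Proof.
case: (boolP (u (lshift m a) != 0%N)) => ua; rewrite ?andbF // !andbT.
rewrite -negb_or; congr (~~ _); apply/orP/vars_predP.
  case=> [/ferrers_predP[i [j [lj _ ui uj]]]|/vars_predP[[i lt_i ui]|[//]]].
    have [lt_ia|le_ai] := ltnP i a; [by left; exists i | right].
    by exists j => //; apply: leq_trans lj (l_anti le_ai).
  by left; exists i.
case=> [[i lt_i ui]|[j lt_j uj]].
  by right; apply/vars_predP; left; exists i.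
by left; apply/ferrers_predP; exists a, j; rewrite ltn_ord.
Qed.

Lemma std_from_rest (a : 'I_n) (u : 'X_{1..N}) :
  std_from a u && ~~ (u (lshift m a) != 0%N) = std_from a.+1 u.
Proof.
rewrite -andbA -negb_or; congr (_ && ~~ _); apply/orP/vars_predP.
  case=> [/vars_predP[[i lt_i ui]|[//]]|ua]; left; last by exists a.
  by exists i => //; apply: ltnW.
case=> [[i lt_i ui]|[//]]; move: lt_i; rewrite ltnS leq_eqVlt => /orP[/eqP ia|lt_i].
  by right; rewrite -(ord_inj ia).
by left; apply/vars_predP; left; exists i.
Qed.

Lemma notin_var_idx_shift (a : 'I_n) (u : 'X_{1..N}) :
  ~~ vars_pred (var_idx n m a (l a)) (u + U_(lshift m a))%MM
  = ~~ vars_pred (var_idx n m a (l a)) u.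
Proof.
congr (~~ _); apply: eq_in_has => k kS; rewrite mnmDE mnm1E.
case: (_ =P k) => [ak|_]; last by rewrite addn0.
by rewrite -ak mem_var_idx_x ltnn in kS.
Qed.

Lemma std_from_count (a : 'I_n) k :
  (mon_count (std_from a) k)%:Z = (mon_count (std_from a.+1) k)%:Z +
    (if k is k'.+1 then fps_exp fps_geom (N - (a + l a)) k' else 0).
Proof.
rewrite (mon_count_split (fun u => u (lshift m a) != 0%N)) addnC PoszD.
rewrite (eq_mon_count _ (std_from_rest a)) (eq_mon_count _ (std_from_first a)).
congr (_ + _); case: k => [|k]; first by rewrite mon_countX0.
rewrite mon_countS (eq_mon_count _ (notin_var_idx_shift a)).
by rewrite mon_count_notin ?uniq_var_idx // size_var_idx // ltnW.
Qed.

(** The monomials without x-variables give 1/(1-t)^m; the others are sorted by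
their first x-variable x_a, and removing it leaves a monomial in the
n + m - (a + l_a) variables allowed by [std_from_first]. *)
Lemma ferrers_std_count k :
  (mon_count (predC (@ferrers_pred n m l n 0)) k)%:Z = fps_exp fps_geom m k +
    \sum_(a < n) (if k is k'.+1 then fps_exp fps_geom (N - (a + l a)) k' else 0).
Proof.
have from b : (b <= n)%N -> (mon_count (std_from 0) k)%:Z = (mon_count (std_from b) k)%:Z +
    \sum_(a < b) (if k is k'.+1 then fps_exp fps_geom (N - (a + l a)) k' else 0).
  elim: b => [_|b IH lt_bn]; first by rewrite big_ord0 addr0.
  rewrite IH ?(ltnW lt_bn) // (std_from_count (Ordinal lt_bn)) /= big_ord_recr /=.
  by rewrite addrAC addrA.
have -> : mon_count (predC (@ferrers_pred n m l n 0)) k = mon_count (std_from 0) k.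
  apply: eq_mon_count => u /=; rewrite (_ : vars_pred _ u = false) ?andbT //.
  by apply/vars_predP => -[] [i].
rewrite (from n) //; congr (_ + _).
rewrite -[m in fps_exp _ m](addKn n) -[X in (_ - X)%N]addn0.
rewrite -(@size_var_idx n m n 0) // -mon_count_notin ?uniq_var_idx //.
congr _%:Z; apply: eq_mon_count => u; rewrite andb_idl // => /vars_predP no_x.
by apply/ferrers_predP => -[i [j [_ _ ui _]]]; apply: no_x; left; exists i.
Qed.

End FerrersHilbert.

(** * Power series modulo a power of the variable *)

Lemma fps_mul1 (g : fps) k : fps_mul (fps_poly 1) g k = g k.
Proof.
rewrite /fps_mul big_ord_recl /= subn0 big1 => [|j _]; last by rewrite /fps_poly coef1 mul0r.
by rewrite /fps_poly coef1 mul1r addr0.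
Qed.

Section Truncation.

Context (k : nat).
Implicit Types (f g : fps) (p q : {poly int}).

(** Identities of power series are checked degree by degree on polynomials that
agree with them up to degree [k], where the ring laws apply. *)
Definition trunc_eq f p := forall i, (i <= k)%N -> f i = p`_i.

Lemma trunc_eq_mul f g p q : trunc_eq f p -> trunc_eq g q ->
  trunc_eq (fps_mul f g) (p * q).
Proof.
move=> fp gq i le_ik; rewrite coefM; apply: eq_bigr => j _.
by rewrite fp ?gq // (leq_trans _ le_ik) ?leq_subr // -ltnS.
Qed.

Lemma trunc_eq_exp f p a : trunc_eq f p -> trunc_eq (fps_exp f a) (p ^+ a).
Proof.
move=> fp; elim: a => [|a IH]; first by move=> i _; rewrite expr0.
by rewrite exprS; apply: trunc_eq_mul.
Qed.

Definition geom_poly : {poly int} := \poly_(i < k.+1) 1.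

Lemma trunc_eq_geom : trunc_eq fps_geom geom_poly.
Proof. by move=> i le_ik; rewrite coef_poly ltnS le_ik. Qed.

(** Up to degree [k], [geom_poly] is inverse to 1 - t. *)
Lemma trunc_eq_one e : trunc_eq (fps_poly 1) (((1 - 'X) * geom_poly) ^+ e).
Proof.
have one i : fps_poly 1 i = fps_exp (fps_poly 1) e i.
  elim: e i => // e IH i.
  by rewrite /fps_exp iterS fps_mul1.
move=> i le_ik; rewrite one; apply: trunc_eq_exp le_ik => j le_jk.
rewrite -fps_geomP; apply: trunc_eq_mul le_jk; last exact: trunc_eq_geom.
by [].
Qed.

Lemma geom_exp_cancel b e : (e <= b)%N ->
  trunc_eq (fps_exp fps_geom (b - e)) (geom_poly ^+ b * (1 - 'X) ^+ e).
Proof.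
move=> le_eb i le_ik.
have -> : geom_poly ^+ b * (1 - 'X) ^+ e
    = ((1 - 'X) * geom_poly) ^+ e * geom_poly ^+ (b - e).
  by rewrite exprMn mulrC -{1}(subnKC le_eb) exprD mulrA.
have := trunc_eq_mul (trunc_eq_one e) (trunc_eq_exp (b - e) trunc_eq_geom) le_ik.
by move=> <-; rewrite fps_mul1.
Qed.

End Truncation.

Lemma hilbert_formula_coef n m (l : nat -> nat) k : (forall i, (l i <= m)%N) ->
  fps_add (fps_exp fps_geom m)
    (fps_mul (fps_mul (fps_poly 'X) (fps_exp fps_geom (m + n + 1)))
       (fps_poly (\sum_(j < n) (1 - 'X) ^+ (l j + j.+1)))) k
  = fps_exp fps_geom m k +
    \sum_(a < n) (if k is k'.+1 then fps_exp fps_geom (n + m - (a + l a)) k' else 0).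
Proof.
move=> l_le; congr (_ + _).
have truncX : trunc_eq k (fps_poly 'X) 'X by [].
have truncG := trunc_eq_exp (m + n + 1) (@trunc_eq_geom k).
have truncS : trunc_eq k (fps_poly (\sum_(j < n) (1 - 'X) ^+ (l j + j.+1)))
                 (\sum_(j < n) (1 - 'X) ^+ (l j + j.+1)) by [].
rewrite (trunc_eq_mul (trunc_eq_mul truncX truncG) truncS) // mulr_sumr coef_sum.
apply: eq_bigr => a _; rewrite -mulrA coefXM; case: k truncX truncG truncS => [|k] _ _ _ //=.
rewrite -(@geom_exp_cancel k.+1 _ _ _ k) //.
  by congr (fps_exp _ _ _); rewrite addn1 addnS subSS addnC [(l a + _)%N]addnC.
by rewrite addn1 addnS ltnS leq_add // ltnW.
Qed.

(** * Decomposition, resolution and Hilbert series of a Ferrers ideal *)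

Theorem theorem2p1 (K : fieldType) (lam : seq nat)
    (lam_neq0 : lam != [::]) (lam_part : is_partition lam) :
  let n := size lam in
  let m := head 0%N lam in
  let s := count (leq 2) lam in
  let I := ferrers_ideal K lam in
  [/\ primary_decomposition I
        ([seq var_gens K n m i (nth 0%N lam i) | i <- iota 0 s]
           ++ [:: var_gens K n m s 1; var_gens K n m n 0]),
      has_two_linear_resolution I /\
      (forall i : nat, (1 <= i <= \max_(j < n) (nth 0 lam j + j))%N ->
         exists2 b : nat, betti I i b &
           b%:Z = \sum_(j < n) 'C(nth 0%N lam j + j, i)%:Z - 'C(n, i.+1)%:Z) &
      exists2 P : fps, hilbert_series I P &
        P =1 fps_add (fps_exp fps_geom m)
               (fps_mul (fps_mul (fps_poly 'X) (fps_exp fps_geom (m + n + 1)))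
                  (fps_poly (\sum_(j < n) (1 - 'X) ^+ (nth 0%N lam j + j.+1))))].
Proof.
move=> n m s I.
have l_anti i j := @is_partition_anti lam i j lam_part.
have l_le i : (nth 0%N lam i <= m)%N := is_partition_le_head i lam_part.
have IE f : mon_ideal (ferrers_pred (nth 0%N lam) n 0) f <-> I f.
  by apply: iff_sym; apply: ferrers_idealE.
have linI : linear_resolution 2 I (ferrers_betti (nth 0%N lam) n 0).
  exact: eq_linear_resolution IE (frefl _) (ferrers_resolution K l_anti l_le (leqnn n)).
have idI : is_ideal I by apply: gen_ideal_is_ideal.
split; first exact: ferrers_primary_decomposition.
  split=> [|[//|i] _].
    by apply: linear_resolution_two_linear linI => // e p /IE Ip; apply/IE/mon_ideal_mpart.
  exists (ferrers_betti (nth 0%N lam) n 0 i.+1); last exact: ferrers_bettiE.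
  exact: linear_resolution_betti linI.
exists (fun k => (mon_count (predC (@ferrers_pred n m (nth 0%N lam) n 0)) k)%:Z).
  move=> k; exists (mon_count (predC (@ferrers_pred n m (nth 0%N lam) n 0)) k) => //.
  have [e [e_hom e_gen e_free]] := dim_quotient_mon K (@ferrers_pred n m (nth 0%N lam) n 0) k.
  exists e; split=> // [f /e_gen[c /IE Ic]|c /IE Ic]; [by exists c | exact: e_free].
by move=> k; rewrite hilbert_formula_coef // ferrers_std_count.
Qed.
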